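(* Let $\mathsf{L}\subseteq\mathcal{L}$ be any set of formulas such that $\mathsf{TWJ}^+\subseteq\mathsf{L}\subseteq\mathrm{Log}(\mathcal{P}_{\mathrm{fin}}(\mathbb{N}),\cup,\varnothing)$. Then $\mathsf{L}$ is undecidable, i.e. there is no algorithm that, given $\varphi\in\mathcal{L}$, decides whether $\varphi\in\mathsf{L}$.
   Context: $\mathcal{L}$ is the set of formulas built from a countably infinite set $\mathsf{Prop}$ of propositional letters by the binary connectives $\land,\lor,\to$. $\mathsf{TWJ}^+$ is the set of formulas derivable in the Hilbert system with axiom schemes (for all formulas $\varphi,\psi,\chi$): (1) $\varphi\to\varphi$; (2) $\varphi\land\psi\to\varphi$; (3) $\varphi\land\psi\to\psi$; (4) $(\varphi\to\psi)\land(\varphi\to\chi)\to(\varphi\to\psi\land\chi)$; (5) $\varphi\to\varphi\lor\psi$; (6) $\psi\to\varphi\lor\psi$; (7) $(\varphi\to\chi)\land(\psi\to\chi)\to(\varphi\lor\psi\to\chi)$; (8) $\varphi\land(\psi\lor\chi)\to(\varphi\land\psi)\lor(\varphi\land\chi)$; (9) $(\varphi\to\psi)\land(\psi\to\chi)\to(\varphi\to\chi)$; (10) $(\varphi\to\psi)\to[(\chi\to\varphi)\to(\chi\to\psi)]$; (11) $(\varphi\to\psi)\to[(\psi\to\chi)\to(\varphi\to\chi)]$; and rules modus ponens (from $\varphi$ and $\varphi\to\psi$ infer $\psi$) and adjunction (from $\varphi$ and $\psi$ infer $\varphi\land\psi$). ($\land,\lor$ bind tighter than $\to$.) $\mathrm{Log}(\mathcal{P}_{\mathrm{fin}}(\mathbb{N}),\cup,\varnothing)$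 is the set of $\varphi\in\mathcal{L}$ such that for every valuation $V:\mathsf{Prop}\to\mathcal{P}(\mathcal{P}_{\mathrm{fin}}(\mathbb{N}))$ we have $\varnothing\Vdash\varphi$, where for finite $x\subseteq\mathbb{N}$: $x\Vdash p$ iff $x\in V(p)$; $x\Vdash\varphi\land\psi$ iff $x\Vdash\varphi$ and $x\Vdash\psi$; $x\Vdash\varphi\lor\psi$ iff $x\Vdash\varphi$ or $x\Vdash\psi$; $x\Vdash\varphi\to\psi$ iff for every finite $y\subseteq\mathbb{N}$ with $y\Vdash\varphi$ we have $x\cup y\Vdash\psi$. *)

(* Defs.v *)
From mathcomp Require Import all_boot finmap zify.

Set Implicit Arguments.
Unset Strict Implicit.
Unset Printing Implicit Defensive.

Local Open Scope nat_scope.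

Inductive formula : Type :=
| Var of nat
| And of formula & formula
| Or of formula & formula
| Imp of formula & formula.

Declare Scope formula_scope.
Delimit Scope formula_scope with F.
Bind Scope formula_scope with formula.
Notation "A ⊓ B" := (And A B) (at level 40, left associativity) : formula_scope.
Notation "A ⊔ B" := (Or A B) (at level 50, left associativity) : formula_scope.
Notation "A ⇒ B" := (Imp A B) (at level 60, right associativity) : formula_scope.

Inductive TWJp : formula -> Prop :=
| TWJ_id A : TWJp (A ⇒ A)
| TWJ_andE1 A B : TWJp (A ⊓ B ⇒ A)
| TWJ_andE2 A B : TWJp (A ⊓ B ⇒ B)
| TWJ_andI A B C : TWJp ((A ⇒ B) ⊓ (A ⇒ C) ⇒ (A ⇒ B ⊓ C))
| TWJ_orI1 A B : TWJp (A ⇒ A ⊔ B)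
| TWJ_orI2 A B : TWJp (B ⇒ A ⊔ B)
| TWJ_orE A B C : TWJp ((A ⇒ C) ⊓ (B ⇒ C) ⇒ (A ⊔ B ⇒ C))
| TWJ_distr A B C : TWJp (A ⊓ (B ⊔ C) ⇒ (A ⊓ B) ⊔ (A ⊓ C))
| TWJ_trans A B C : TWJp ((A ⇒ B) ⊓ (B ⇒ C) ⇒ (A ⇒ C))
| TWJ_prefix A B C : TWJp ((A ⇒ B) ⇒ ((C ⇒ A) ⇒ (C ⇒ B)))
| TWJ_suffix A B C : TWJp ((A ⇒ B) ⇒ ((B ⇒ C) ⇒ (A ⇒ C)))
| TWJ_mp A B : TWJp A -> TWJp (A ⇒ B) -> TWJp B
| TWJ_adj A B : TWJp A -> TWJp B -> TWJp (A ⊓ B).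

Fixpoint forces (V : nat -> {fset nat} -> Prop) (x : {fset nat}) (A : formula)
    : Prop :=
  match A with
  | Var p => V p x
  | And B C => forces V x B /\ forces V x C
  | Or B C => forces V x B \/ forces V x C
  | Imp B C => forall y : {fset nat}, forces V y B -> forces V (x `|` y)%fset C
  end.

Definition LogPfin (A : formula) : Prop :=
  forall V : nat -> {fset nat} -> Prop, forces V fset0 A.

(* Kleene's partial recursive functions, with their arity. *)
Inductive recfun : nat -> Type :=
| Rzero n : recfun n
| Rsucc : recfun 1
| Rproj n of 'I_n : recfun n
| Rcomp k n of recfun k & ('I_k -> recfun n) : recfun n
| Rprec n of recfun n & recfun n.+2 : recfun n.+1
| Rmin n of recfun n.+1 : recfun n.

(* The graph of primitive recursion with base graph [F] and step graph [G];
   the step function takes the counter, then the previous value. *)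
Fixpoint prec_graph n (F : n.-tuple nat -> nat -> Prop)
    (G : n.+2.-tuple nat -> nat -> Prop) (m : nat) (v : n.-tuple nat) (y : nat)
    : Prop :=
  match m with
  | 0 => F v y
  | m'.+1 => exists z, prec_graph F G m' v z /\ G [tuple of m' :: z :: v] y
  end.

(* [computes f v y]: the computation of [f] on [v] converges, with value [y].
   In [Rprec] and [Rmin] the distinguished argument comes first. *)
Fixpoint computes n (f : recfun n) : n.-tuple nat -> nat -> Prop :=
  match f in recfun n return n.-tuple nat -> nat -> Prop with
  | Rzero _ => fun _ y => y = 0
  | Rsucc => fun v y => y = (thead v).+1
  | Rproj _ i => fun v y => y = tnth v i
  | Rcomp k _ h g => fun v y =>
      exists w : k.-tuple nat,
        (forall i, computes (g i) v (tnth w i)) /\ computes h w y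
  | Rprec _ h g => fun v y =>
      prec_graph (computes h) (computes g) (thead v) [tuple of behead v] y
  | Rmin _ h => fun v y =>
      computes h [tuple of y :: v] 0 /\
      forall m, m < y -> exists z, computes h [tuple of m :: v] z.+1
  end.

Definition cpair (a b : nat) : nat := 'C((a + b).+1, 2) + b.

(* Goedel numbering: Cantor pairing, with the main connective read off mod 4. *)
Fixpoint code (A : formula) : nat :=
  match A with
  | Var p => 4 * p
  | And B C => 4 * cpair (code B) (code C) + 1
  | Or B C => 4 * cpair (code B) (code C) + 2
  | Imp B C => 4 * cpair (code B) (code C) + 3
  end.

Lemma cpair_inj a b c d : cpair a b = cpair c d -> a = c /\ b = d.
Proof.
have mono s t u v : s < t -> u <= s -> 'C(s.+1, 2) + u < 'C(t.+1, 2) + v.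
  move=> st us; have : 'C(s.+2, 2) <= 'C(t.+1, 2) by apply: leq_bin2l.
  rewrite (binS s.+1 1) bin1; lia.
rewrite /cpair => e; have s_eq : a + b = c + d.
  case: (ltngtP (a + b) (c + d)) => // lt.
  - have := mono _ _ b d lt (leq_addl _ _); lia.
  - have := mono _ _ d b lt (leq_addl _ _); lia.
rewrite s_eq in e; lia.
Qed.

Lemma code_inj : injective code.
Proof.
elim=> [p|A IA B IB|A IA B IB|A IA B IB] [q|C D|C D|C D] /= e;
  try (exfalso; lia); first by congr Var; lia.
all: have /cpair_inj[/IA -> /IB ->] // :
  cpair (code A) (code B) = cpair (code C) (code D) by lia.
Qed.

(* The characteristic function of [L], on Goedel numbers, is recursive. *)
Definition rec_decidable (L : formula -> Prop) : Prop :=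
  exists f : recfun 1, forall A : formula,
    exists b : bool, computes f [tuple code A] b /\ (L A <-> b = true).

(* Main.v *)
From HB Require Import structures.
From Stdlib Require Import Classical.
From mathcomp Require Import all_boot finmap zify.
Require Import Defs.

(* Conjoining finitely many implications [A ⇒ B], together with [p ⇒ p] for all
   letters in sight, gives a formula [G] such that [G ⇒ A ⇒ B] is derivable in
   TWJ+ as soon as [A ⇒ B] follows from them in an inequational calculus of
   distributive lattices with an implication subject to the prefix and suffix
   laws. In turn, [G] holds at the empty set iff the implications hold globally.

   A run of a register machine is laid out on a grid of finite sets: the even
   members of a set form the interval of length [t] (the time), the odd ones that
   of length [i] (the column), and register [r] is displayed in row [t] by the
   letter [b_r] in the columns before its value and [z_r] in the column equal to
   it. Letters [S] and [A] hold at the singletons extending a row or a column; an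
   extension may fail to reach the next row or column, but this is visible in the
   parities of the lengths or in a gap. A configuration is thus a formula, and one
   step is an implication from it to [S ⇒ stuck ⊔ next configuration]. If the
   machine halts, this refutes its initial configuration, backwards from the
   halting state. If not, the run itself is a countermodel.

   Finally, for a decider [f] of [L], a machine can compute [f] on the formula
   with theory [k] and input [k], and halt iff the answer is negative; [k] being
   the code of the theory of that very machine, this contradicts the above. No
   universal machine is needed, and compiled programs need only be correct where
   the function converges. *)

Set Implicit Arguments.
Unset Strict Implicit.
Unset Printing Implicit Defensive.

Local Open Scope nat_scope.

(** * Derivability in [TWJp] and an inequational calculus on top of it *)

Lemma formula_comparable : comparable formula.
Proof.
rewrite /comparable /decidable; decide equality; exact: eq_comparable.
Qed.

HB.instance Definition _ :=
  hasDecEq.Build formula (compareP formula_comparable).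

Lemma TWJp_comp A B C : TWJp (A ⇒ B) -> TWJp (B ⇒ C) -> TWJp (A ⇒ C).
Proof. by move=> AB BC; exact: TWJ_mp BC (TWJ_mp AB (TWJ_suffix _ _ _)). Qed.

Lemma TWJp_and A B C : TWJp (A ⇒ B) -> TWJp (A ⇒ C) -> TWJp (A ⇒ B ⊓ C).
Proof. by move=> AB AtoC; exact: TWJ_mp (TWJ_adj AB AtoC) (TWJ_andI _ _ _). Qed.

Fixpoint maxvar (A : formula) : nat :=
  match A with
  | Var p => p
  | And B C | Or B C | Imp B C => maxn (maxvar B) (maxvar C)
  end.

Fixpoint clamp M (A : formula) : formula :=
  match A with
  | Var p => Var (minn p M)
  | And B C => And (clamp M B) (clamp M C)
  | Or B C => Or (clamp M B) (clamp M C)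
  | Imp B C => Imp (clamp M B) (clamp M C)
  end.

Lemma clamp_id M A : maxvar A <= M -> clamp M A = A.
Proof.
elim: A => [p|A IA B IB|A IA B IB|A IA B IB] /=; first by move/minn_idPl->.
all: by rewrite geq_max => /andP[/IA-> /IB->].
Qed.

(** The language has no constant for truth; the derivable [Var 0 ⇒ Var 0] ends the list instead. *)
Definition conj (l : seq formula) : formula := foldr And (Var 0 ⇒ Var 0)%F l.

Definition theory_bound (N : nat) (Ax : seq formula) : nat :=
  maxn N (\max_(A <- Ax) maxvar A).

(* The identities [p ⇒ p] make every theorem [A ⇒ B] in these letters hold at
   all worlds forcing the theory, not just at the base world. *)
Definition theory (N : nat) (Ax : seq formula) : formula :=
  conj (Ax ++ [seq (Var p ⇒ Var p)%F | p <- iota 0 (theory_bound N Ax).+1]).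

Lemma TWJp_conj l A : A \in l -> TWJp (conj l ⇒ A).
Proof.
elim: l => //= B l IH; rewrite inE => /orP[/eqP->|/IH Al].
  exact: TWJ_andE1.
exact: TWJp_comp (TWJ_andE2 _ _) Al.
Qed.

Section Calculus.

Variables (N : nat) (Ax : seq formula).
Let M := theory_bound N Ax.

(* Clamping the letters to those of the theory spares side conditions. *)
Definition entails A B := TWJp (theory N Ax ⇒ clamp M A ⇒ clamp M B).
Local Notation "A ⊑ B" := (entails A%F B%F) (at level 70).

(** Putting [A ⇒ A] under the premise [theory N Ax] is a weakening, which TWJ+ does not offer. It is
    built up from the identities on letters in the theory; for an implication, prefixing the
    identity of its conclusion suffices. *)
Lemma le_refl A : A ⊑ A.
Proof.
rewrite /entails; elim: A => [p|A IA B IB|A IA B IB|A IA B IB] /=.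
- apply: TWJp_conj; rewrite mem_cat; apply/orP; right.
  by apply: map_f; rewrite mem_iota; lia.
- apply: TWJp_comp (TWJ_andI _ _ _); apply: TWJp_and.
    exact: TWJp_comp IA (TWJ_mp (TWJ_andE1 _ _) (TWJ_suffix _ _ _)).
  exact: TWJp_comp IB (TWJ_mp (TWJ_andE2 _ _) (TWJ_suffix _ _ _)).
- apply: TWJp_comp (TWJ_orE _ _ _); apply: TWJp_and.
    exact: TWJp_comp IA (TWJ_mp (TWJ_orI1 _ _) (TWJ_prefix _ _ _)).
  exact: TWJp_comp IB (TWJ_mp (TWJ_orI2 _ _) (TWJ_prefix _ _ _)).
- exact: TWJp_comp IB (TWJ_prefix _ _ _).
Qed.

Lemma le_thm A B : TWJp (clamp M A ⇒ clamp M B) -> A ⊑ B.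
Proof.
by move=> AB; exact: TWJp_comp (le_refl A) (TWJ_mp AB (TWJ_prefix _ _ _)).
Qed.

Lemma le_axiom A B : (A ⇒ B)%F \in Ax -> A ⊑ B.
Proof.
move=> AB; have : maxvar (A ⇒ B)%F <= M.
  rewrite /M /theory_bound leq_max; apply/orP; right.
  exact: (leq_bigmax_seq (F := maxvar) _ AB).
rewrite /= geq_max => /andP[A_le B_le]; rewrite /entails !clamp_id //.
by apply: TWJp_conj; rewrite mem_cat AB.
Qed.

(** The conjunctive form of transitivity, [TWJ_trans], lets a single copy of the theory serve both
    hypotheses without contraction. *)
Lemma le_trans B A C : A ⊑ B -> B ⊑ C -> A ⊑ C.
Proof. by move=> AB BC; exact: TWJp_comp (TWJp_and AB BC) (TWJ_trans _ _ _). Qed.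

Lemma le_andl A B : A ⊓ B ⊑ A. Proof. exact/le_thm/TWJ_andE1. Qed.
Lemma le_andr A B : A ⊓ B ⊑ B. Proof. exact/le_thm/TWJ_andE2. Qed.
Lemma le_orl A B : A ⊑ A ⊔ B. Proof. exact/le_thm/TWJ_orI1. Qed.
Lemma le_orr A B : B ⊑ A ⊔ B. Proof. exact/le_thm/TWJ_orI2. Qed.

Lemma le_and A B C : A ⊑ B -> A ⊑ C -> A ⊑ B ⊓ C.
Proof. by move=> AB AtoC; exact: TWJp_comp (TWJp_and AB AtoC) (TWJ_andI _ _ _). Qed.

Lemma le_or A B C : A ⊑ C -> B ⊑ C -> A ⊔ B ⊑ C.
Proof. by move=> AtoC BC; exact: TWJp_comp (TWJp_and AtoC BC) (TWJ_orE _ _ _). Qed.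

Lemma le_distr A B C : A ⊓ (B ⊔ C) ⊑ (A ⊓ B) ⊔ (A ⊓ C).
Proof. exact/le_thm/TWJ_distr. Qed.

Lemma le_imp_and A B C X : X ⊑ (A ⇒ B) -> X ⊑ (A ⇒ C) -> X ⊑ (A ⇒ B ⊓ C).
Proof.
by move=> XB XC; apply: le_trans (le_and XB XC) _; exact/le_thm/TWJ_andI.
Qed.

Lemma le_imp_or A B C X : X ⊑ (A ⇒ C) -> X ⊑ (B ⇒ C) -> X ⊑ (A ⊔ B ⇒ C).
Proof.
by move=> XB XC; apply: le_trans (le_and XB XC) _; exact/le_thm/TWJ_orE.
Qed.

Lemma le_prefix A B C : (A ⇒ B) ⊑ ((C ⇒ A) ⇒ (C ⇒ B)).
Proof. exact/le_thm/TWJ_prefix. Qed.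

Lemma le_suffix A B C : (A ⇒ B) ⊑ ((B ⇒ C) ⇒ (A ⇒ C)).
Proof. exact/le_thm/TWJ_suffix. Qed.

Lemma le_impr A B C : B ⊑ C -> (A ⇒ B) ⊑ (A ⇒ C).
Proof. by move=> BC; exact: TWJp_comp BC (TWJ_prefix _ _ _). Qed.

Lemma le_impl A B C : B ⊑ A -> (A ⇒ C) ⊑ (B ⇒ C).
Proof. by move=> BA; exact: TWJp_comp BA (TWJ_suffix _ _ _). Qed.

Lemma le_imp A B A' B' X : X ⊑ (A ⇒ B) -> A' ⊑ A -> B ⊑ B' -> X ⊑ (A' ⇒ B').
Proof.
by move=> XAB A'A BB'; apply: le_trans XAB (le_trans (le_impl _ A'A) (le_impr _ BB')).
Qed.

Lemma le_and2 A B C D : A ⊑ C -> B ⊑ D -> A ⊓ B ⊑ C ⊓ D.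
Proof.
by move=> AtoC BD; apply: le_and; [apply: le_trans AtoC | apply: le_trans BD];
  [exact: le_andl | exact: le_andr].
Qed.

Lemma le_or2 A B C D : A ⊑ C -> B ⊑ D -> A ⊔ B ⊑ C ⊔ D.
Proof.
by move=> AtoC BD; apply: le_or; [apply: le_trans AtoC _ | apply: le_trans BD _];
  [exact: le_orl | exact: le_orr].
Qed.

Lemma le_andlt A B C : A ⊑ C -> A ⊓ B ⊑ C.
Proof. exact/le_trans/le_andl. Qed.

Lemma le_andrt A B C : B ⊑ C -> A ⊓ B ⊑ C.
Proof. exact/le_trans/le_andr. Qed.

Lemma le_orlt A B C : A ⊑ B -> A ⊑ B ⊔ C.
Proof. by move=> AB; exact: le_trans AB (le_orl _ _). Qed.

Lemma le_orrt A B C : A ⊑ C -> A ⊑ B ⊔ C.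
Proof. by move=> AtoC; exact: le_trans AtoC (le_orr _ _). Qed.

Lemma le_andC A B : A ⊓ B ⊑ B ⊓ A.
Proof. exact/le_and/le_andl/le_andr. Qed.

Lemma le_or_and A B C : (A ⊔ B) ⊓ C ⊑ A ⊔ (B ⊓ C).
Proof.
apply: le_trans (le_andC _ _) _; apply: le_trans (le_distr _ _ _) _.
by apply: le_or2; [exact: le_andr | exact: le_andC].
Qed.

Lemma le_imp_or_and A B C D X :
  X ⊑ (A ⇒ B ⊔ C) -> X ⊑ (A ⇒ B ⊔ D) -> X ⊑ (A ⇒ B ⊔ (C ⊓ D)).
Proof.
move=> XC XD; apply: le_imp (le_imp_and XC XD) (le_refl _) _.
apply: le_trans (le_or_and _ _ _) _; apply: le_or; first exact: le_orl.
apply: le_trans (le_andC _ _) _; apply: le_trans (le_or_and _ _ _) _.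
by apply: le_or2; [exact: le_refl | exact: le_andC].
Qed.

End Calculus.

(** * Register machines *)

Inductive instr := IInc of nat & nat | IDec of nat & nat & nat.

Definition upd (c : nat -> nat) (r v : nat) : nat -> nat :=
  fun r' => if r' == r then v else c r'.

Definition config := (nat * (nat -> nat))%type.

Definition exec_instr (i : instr) (c : nat -> nat) : config :=
  match i with
  | IInc r l => (l, upd c r (c r).+1)
  | IDec r l0 l1 => if c r == 0 then (l0, c) else (l1, upd c r (c r).-1)
  end.

Definition step (P : seq instr) (s : config) : config :=
  if onth P s.1 is Some i then exec_instr i s.2 else s.

Definition reg (i : instr) := match i with IInc r _ | IDec r _ _ => r end.

(** * Encoding of a register machine *)

Section Encoding.
Local Open Scope formula_scope.

(* Intended meanings are those of [grid_val] below. *)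
Definition fbot := Var 0.
Definition fS := Var 1.
Definition fA := Var 2.
Definition fstart := Var 3.
Definition fcol0 := Var 4.
Definition xbad := Var 5.
Definition ybad := Var 6.
Definition fx (k : bool) := Var (7 + k).
Definition fy (k : bool) := Var (9 + k).
Definition fq (l : nat) := Var (11 + 3 * l).
Definition fb (r : nat) := Var (12 + 3 * r).
Definition fz (r : nat) := Var (13 + 3 * r).

(** Adding an odd singleton to a set in a column of parity [k] breaks the column ([ybad]), leaves it
    unchanged ([fy k]), or moves one column on, where the parity flips and only [E] remains. *)
Definition next_col (E : formula) : formula :=
  (fy false ⊓ (fA ⇒ (ybad ⊔ fy false) ⊔ E))
  ⊔ (fy true ⊓ (fA ⇒ (ybad ⊔ fy true) ⊔ E)).

Definition num_from (r n : nat) (E : formula) :=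
  iter n (fun F => fb r ⊓ next_col F) E.

Definition num (r n : nat) := num_from r n (fz r).

(** The failed outcomes of adding an even singleton to a row of parity [k]: no row results, or the
    old one remains. *)
Definition stuck (k : bool) := xbad ⊔ fx k.

(** A rule [(L, R)] reads [L] in one row and asserts [R] in the next, at the same column. [IDec] on
    a zero register has no cell to remove, so the middle rule carries its [fz r] over. *)
Definition control_rules (k : bool) (i : instr) : seq (formula * formula) :=
  match i with
  | IInc r l => [:: (fcol0, fcol0 ⊓ (fx (~~ k) ⊓ fq l))]
  | IDec r l0 l1 =>
      [:: (fcol0 ⊓ fz r, fcol0 ⊓ (fx (~~ k) ⊓ fq l0));
          (fcol0 ⊓ fz r, fz r);
          (fcol0 ⊓ fb r, fcol0 ⊓ (fx (~~ k) ⊓ fq l1))]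
  end.

(** Incrementing replaces the end mark by a cell followed by the mark; decrementing peeks one column
    ahead, so that the last cell becomes the mark. *)
Definition active_rules (i : instr) : seq (formula * formula) :=
  match i with
  | IInc r _ => [:: (fz r, fb r ⊓ next_col (fz r)); (fb r, fb r)]
  | IDec r _ _ => [:: (fb r ⊓ next_col (fz r), fz r); (fb r ⊓ next_col (fb r), fb r)]
  end.

Definition idle_rules (r : nat) : seq (formula * formula) :=
  [:: (fz r, fz r); (fb r, fb r)].

Definition instr_rules (K : nat) (k : bool) (i : instr) :=
  control_rules k i ++ active_rules i
  ++ flatten [seq idle_rules r | r <- iota 0 K & r != reg i].

Definition here (k : bool) (l : nat) := fx k ⊓ fq l.

(* Both orders of fusion of a row with an [fS] are needed, as TWJ+ lacks
   commutativity. *)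
Definition rule_axioms k l (LR : formula * formula) : seq formula :=
  [:: fS ⇒ (here k l ⊓ LR.1 ⇒ stuck k ⊔ LR.2);
      here k l ⊓ LR.1 ⇒ (fS ⇒ stuck k ⊔ LR.2)].

(** The last axiom expresses progress, in contrapositive form: not every even singleton can fail to
    extend the row. *)
Definition grid_axioms (k : bool) : seq formula :=
  [:: fx k ⊓ stuck (~~ k) ⇒ fbot;
      fx k ⇒ (fA ⇒ fx k);
      fS ⇒ (fy k ⇒ fy k);
      fy k ⇒ (fS ⇒ fy k);
      fx k ⊓ (fS ⇒ stuck k) ⇒ fbot].

Definition num_regs (P : seq instr) := (\max_(i <- P) reg i).+1.

(** [fbot] is a mere letter, so its explosive behaviour is postulated letter by letter. Reaching the
    halting address [size P] counts as absurd, and register 0 is left free for the input. *)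
Definition axioms (P : seq instr) (l : nat) : seq formula :=
  let K := num_regs P in
  [:: fbot ⇒ fy false; fbot ⇒ (fA ⇒ fbot); fbot ⇒ xbad; fS ⇒ (ybad ⇒ ybad);
      fq (size P) ⇒ fbot; fstart ⇒ fcol0 ⊓ here false l]
  ++ [seq fstart ⇒ fz r | r <- iota 1 K]
  ++ [seq fbot ⇒ fb r | r <- iota 0 K] ++ [seq fbot ⇒ fz r | r <- iota 0 K]
  ++ [seq fq m ⇒ (fA ⇒ fq m) | m <- iota 0 (size P)]
  ++ flatten [seq grid_axioms k | k <- [:: false; true]]
  ++ flatten [seq flatten [seq rule_axioms k m LR
                          | LR <- oapp (instr_rules K k) [::] (onth P m)]
             | k <- [:: false; true], m <- iota 0 (size P)].

(* [Var 13] is the largest letter of [num 0 n], hence of the goal below. *)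
Definition machine_theory P l := theory 13 (axioms P l).

Definition halting_formula P l n :=
  machine_theory P l ⇒ (fstart ⊓ num 0 n ⇒ fbot).

Definition conf K k l c :=
  foldr (fun r F => num r (c r) ⊓ F) (fcol0 ⊓ here k l) (iota 0 K).
End Encoding.

(** * Halting runs give derivations *)

Section Derivation.

Variables (P : seq instr) (l0 : nat).
Let K := num_regs P.
Local Notation "A ⊑ B" := (entails 13 (axioms P l0) A%F B%F) (at level 70).

Lemma le_base A B :
  (A ⇒ B)%F \in [:: fbot ⇒ fy false; fbot ⇒ (fA ⇒ fbot); fbot ⇒ xbad;
    fS ⇒ (ybad ⇒ ybad); fq (size P) ⇒ fbot; fstart ⇒ fcol0 ⊓ here false l0]%F ->
  A ⊑ B.
Proof. by move=> AB; apply: le_axiom; rewrite /axioms mem_cat AB. Qed.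

Lemma le_grid k A B : (A ⇒ B)%F \in grid_axioms k -> A ⊑ B.
Proof.
move=> AB; apply: le_axiom; rewrite /axioms !mem_cat; do 5 (apply/orP; right).
by case: k AB => ->; rewrite ?orbT.
Qed.

Lemma le_bot_b r : r < K -> fbot ⊑ fb r.
Proof.
move=> rK; apply: le_axiom; rewrite /axioms !mem_cat; do 2 (apply/orP; right).
by apply/orP; left; apply: (map_f (fun r => fbot ⇒ fb r)%F); rewrite mem_iota.
Qed.

Lemma le_bot_z r : r < K -> fbot ⊑ fz r.
Proof.
move=> rK; apply: le_axiom; rewrite /axioms !mem_cat; do 3 (apply/orP; right).
by apply/orP; left; apply: (map_f (fun r => fbot ⇒ fz r)%F); rewrite mem_iota.
Qed.

Lemma le_start_z r : 0 < r <= K -> fstart ⊑ fz r.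
Proof.
move=> rK; apply: le_axiom; rewrite /axioms !mem_cat; do 1 (apply/orP; right).
by apply/orP; left; apply: (map_f (fun r => fstart ⇒ fz r)%F); rewrite mem_iota.
Qed.

Lemma le_state m : m < size P -> fq m ⊑ (fA ⇒ fq m).
Proof.
move=> mP; apply: le_axiom; rewrite /axioms !mem_cat; do 4 (apply/orP; right).
by apply/orP; left; apply: (map_f (fun m => fq m ⇒ (fA ⇒ fq m))%F); rewrite mem_iota.
Qed.

Lemma rule_in k m i LR A : onth P m = Some i -> LR \in instr_rules K k i ->
  A \in rule_axioms k m LR -> A \in axioms P l0.
Proof.
move=> Pm LRi ALR; rewrite /axioms !mem_cat; do 6 (apply/orP; right).
apply/flattenP; exists (flatten [seq rule_axioms k m LR | LR <- instr_rules K k i]).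
  apply/allpairsP; exists (k, m); split=> /=; first by case: (k).
    by rewrite mem_iota /= add0n -onthTE Pm.
  by rewrite Pm.
by apply/flatten_mapP; exists LR.
Qed.

Lemma le_rule_S k m i L R : onth P m = Some i -> (L, R) \in instr_rules K k i ->
  fS ⊑ (here k m ⊓ L ⇒ stuck k ⊔ R).
Proof.
by move=> Pm LR; apply/le_axiom/(rule_in Pm LR); rewrite inE eqxx.
Qed.

Lemma le_S_rule k m i L R : onth P m = Some i -> (L, R) \in instr_rules K k i ->
  here k m ⊓ L ⊑ (fS ⇒ stuck k ⊔ R).
Proof.
by move=> Pm LR; apply/le_axiom/(rule_in Pm LR); rewrite !inE eqxx orbT.
Qed.

Lemma bot_next E : fbot ⊑ E -> fbot ⊑ next_col E.
Proof.
move=> bE; apply: le_orlt; apply: le_and; first by apply: le_base; rewrite inE eqxx.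
apply: (@le_trans _ _ (fA ⇒ fbot)); first by apply: le_base; rewrite !inE eqxx orbT.
by apply: le_impr; apply: le_orrt.
Qed.

Lemma bot_num r n : r < K -> fbot ⊑ num r n.
Proof.
move=> rK; elim: n => [|n IH]; first exact: le_bot_z.
by apply: le_and; [exact: le_bot_b | exact: bot_next].
Qed.

Lemma bot_stuck k : fbot ⊑ stuck k.
Proof. by apply: le_orlt; apply: le_base; rewrite !inE eqxx !orbT. Qed.

Lemma next_mono E F : E ⊑ F -> next_col E ⊑ next_col F.
Proof.
move=> EF; apply: le_or2; apply: le_and2; try exact: le_refl.
all: by apply: le_impr; apply: le_or2 => //; exact: le_refl.
Qed.

(** A property insensitive to [fA], such as the row parity or the control state, travels along to
    the next column. *)
Lemma next_and W E : W ⊑ (fA ⇒ W) -> W ⊓ next_col E ⊑ next_col (W ⊓ E).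
Proof.
move=> WW; apply: le_trans (le_distr _ _ _ _ _) _.
apply: le_or2; apply: le_and; try (by apply: le_andrt; exact: le_andl).
all: apply: (@le_trans _ _ (fA ⇒ W ⊓ (_ ⊔ E))).
1,3: by apply: le_imp_and; [exact: le_andlt | apply: le_andrt; exact: le_andr].
all: apply: le_impr; apply: le_trans (le_distr _ _ _ _ _) _.
all: by apply: le_or2; [exact: le_andr | exact: le_refl].
Qed.

Lemma S_same_col k E F : fS ⊑ (E ⇒ F) ->
  fS ⊑ ((ybad ⊔ fy k) ⊔ E ⇒ (ybad ⊔ fy k) ⊔ F).
Proof.
move=> EF; apply: le_imp_or; last first.
  by apply: le_imp EF _ _; [exact: le_refl | exact: le_orr].
apply: le_imp_or; last first.
  apply: (@le_imp _ _ (fy k) (fy k)).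
  - by apply: (@le_grid k); rewrite !inE eqxx !orbT.
  - exact: le_refl.
  - by apply: le_orlt; exact: le_orr.
apply: (@le_imp _ _ ybad ybad).
- by apply: le_base; rewrite !inE eqxx !orbT.
- exact: le_refl.
- by apply: le_orlt; exact: le_orl.
Qed.

Lemma S_next E F : fS ⊑ (E ⇒ F) -> fS ⊑ (next_col E ⇒ next_col F).
Proof.
move=> EF.
have side k : fS ⊑ (fy k ⊓ (fA ⇒ (ybad ⊔ fy k) ⊔ E) ⇒
                    fy k ⊓ (fA ⇒ (ybad ⊔ fy k) ⊔ F)).
  apply: le_imp_and.
    apply: (@le_imp _ _ (fy k) (fy k)); last exact: le_refl.
      by apply: (@le_grid k); rewrite !inE eqxx !orbT.
    exact: le_andl.
  apply: le_imp (le_trans (S_same_col k EF) (le_prefix _ _ _ _ fA)) _ (le_refl _ _ _).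
  exact: le_andr.
apply: le_imp_or; apply: le_imp (side _) (le_refl _ _ _) _; first exact: le_orl.
exact: le_orr.
Qed.

(** Here [fS] is fused on the right, so the column step is composed by suffixing, where [S_next]
    prefixes; the hypothesis still has [fS] on the left. *)
Lemma next_S E F : fS ⊑ (E ⇒ F) -> next_col E ⊑ (fS ⇒ next_col F).
Proof.
move=> EF.
have side k : fy k ⊓ (fA ⇒ (ybad ⊔ fy k) ⊔ E) ⊑
              (fS ⇒ fy k ⊓ (fA ⇒ (ybad ⊔ fy k) ⊔ F)).
  apply: le_imp_and; first by apply: le_andlt; apply: (@le_grid k);
    rewrite !inE eqxx !orbT.
  apply: le_andrt; apply: le_trans (le_suffix _ _ _ _ _) _.
  by apply: le_impl; exact: S_same_col EF.
apply: le_or; apply: le_trans (side _) _; apply: le_impr; first exact: le_orl.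
exact: le_orr.
Qed.

(** The rules act column by column, each application producing its own [stuck] disjunct; these are
    cleared only once the parity of the next row is known. *)
Definition unless_stuck k r n E :=
  iter n (fun F => (stuck k ⊔ fb r) ⊓ next_col F)%F (stuck k ⊔ E)%F.

Lemma here_A k m : m < size P -> here k m ⊑ (fA ⇒ here k m).
Proof.
move=> mP; apply: le_imp_and; [apply: le_andlt | exact/le_andrt/le_state].
by apply: (@le_grid k); rewrite !inE eqxx !orbT.
Qed.

Section Transport.

Variables (k : bool) (m r : nat) (E F : formula).
Hypotheses (mP : m < size P)
  (S_end : fS ⊑ (here k m ⊓ E ⇒ stuck k ⊔ F))
  (end_S : here k m ⊓ E ⊑ (fS ⇒ stuck k ⊔ F))
  (S_in : forall n, fS ⊑ (here k m ⊓ num_from r n.+1 E ⇒ stuck k ⊔ fb r))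
  (in_S : forall n, here k m ⊓ num_from r n.+1 E ⊑ (fS ⇒ stuck k ⊔ fb r)).

Lemma S_num_from n : fS ⊑ (here k m ⊓ num_from r n E ⇒ unless_stuck k r n F).
Proof.
elim: n => [|n IH] //=; apply: le_imp_and; first exact: S_in.
apply: le_imp (S_next IH) _ (le_refl _ _ _).
apply: le_trans (next_and _ (here_A k mP)).
by apply: le_and2; [exact: le_refl | exact: le_andr].
Qed.

(** Only the outermost column uses the hypotheses with [fS] on the right; past it, [next_S] reduces
    to the other order. *)
Lemma num_from_S n : here k m ⊓ num_from r n E ⊑ (fS ⇒ unless_stuck k r n F).
Proof.
case: n => [|n] //=; apply: le_imp_and; first exact: in_S.
apply: le_trans (next_S (S_num_from n)).
apply: le_trans (next_and _ (here_A k mP)).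
by apply: le_and2; [exact: le_refl | exact: le_andr].
Qed.

End Transport.

Lemma not_stuck k E : fbot ⊑ E -> fx (~~ k) ⊓ (stuck k ⊔ E) ⊑ E.
Proof.
move=> bE; apply: le_trans (le_distr _ _ _ _ _) _; apply: le_or; last exact: le_andr.
apply: le_trans bE; apply: (@le_grid (~~ k)); by rewrite /grid_axioms negbK inE eqxx.
Qed.

(** Row parity is insensitive to [fA], so [fx (~~ k)] accompanies the display through all columns
    and refutes [stuck k] in each. *)
Lemma unless_stuckP k r n e : r < K ->
  fx (~~ k) ⊓ unless_stuck k r n (num r e) ⊑ num r (n + e).
Proof.
move=> rK; elim: n => [|n IH]; first exact/not_stuck/bot_num.
apply: le_and.
  apply: le_trans (not_stuck k (le_bot_b rK)).
  by apply: le_and2; [exact: le_refl | exact: le_andl].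
apply: le_trans (next_mono IH); apply: le_trans (next_and _ _).
  by apply: le_and2; [exact: le_refl | exact: le_andr].
by apply: (@le_grid (~~ k)); rewrite !inE eqxx !orbT.
Qed.

Lemma num_fromE r n e : num_from r n (num r e) = num r (n + e).
Proof. by rewrite /num /num_from iterD. Qed.

Lemma conf_num k m c r : r < K -> conf K k m c ⊑ num r (c r).
Proof.
rewrite /conf => rK; have : r \in iota 0 K by rewrite mem_iota.
elim: (iota 0 K) => //= r' s IH; rewrite inE => /orP[/eqP<-|/IH rs].
  exact: le_andl.
exact: le_andrt.
Qed.

Lemma conf_here k m c : conf K k m c ⊑ fcol0 ⊓ here k m.
Proof.
rewrite /conf; elim: (iota 0 K) => [|r s IH] /=; first exact: le_refl.
exact: le_andrt.
Qed.

Lemma le_conf X B k m c :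
  X ⊑ (fS ⇒ B ⊔ fcol0 ⊓ here k m) ->
  (forall r, r < K -> X ⊑ (fS ⇒ B ⊔ num r (c r))) ->
  X ⊑ (fS ⇒ B ⊔ conf K k m c).
Proof.
rewrite /conf => Xh Xn; have : {subset iota 0 K <= gtn K}.
  by move=> r; rewrite mem_iota.
elim: (iota 0 K) => [|r s IH] //= sK; apply: le_imp_or_and.
  by apply: Xn; apply: sK; rewrite inE eqxx.
by apply: IH => r' r's; apply: sK; rewrite inE r's orbT.
Qed.

Lemma reg_lt m i : onth P m = Some i -> reg i < K.
Proof.
rewrite /K /num_regs ltnS; elim: P m => [|a s IH] [|m] //=; rewrite big_cons.
  by case=> ->; exact: leq_maxl.
by move/IH=> le_max; exact: leq_trans le_max (leq_maxr _ _).
Qed.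

Lemma unless_stuck_num X C k r n e : r < K -> C ⊑ fx (~~ k) ->
  X ⊑ (fS ⇒ stuck k ⊔ C) -> X ⊑ (fS ⇒ unless_stuck k r n (num r e)) ->
  X ⊑ (fS ⇒ stuck k ⊔ num r (n + e)).
Proof.
move=> rK Ck XC Xn; apply: le_imp (le_imp_and XC Xn) (le_refl _ _ _) _.
apply: le_trans (le_or_and _ _ _ _ _) _; apply: le_or2; first exact: le_refl.
apply: le_trans (unless_stuckP k n e rK).
by apply: le_and2 => //; exact: le_refl.
Qed.

Lemma num_ge_b r n e : num_from r n (num r e.+1) ⊑ fb r.
Proof. by rewrite num_fromE addnS; exact: le_andl. Qed.

(** The next configuration is assembled conjunct by conjunct: control by a rule in column 0,
    registers by transport along their display. *)
Lemma conf_step k m c i : onth P m = Some i ->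
  conf K k m c ⊑
  (fS ⇒ stuck k ⊔ conf K (~~ k) (exec_instr i c).1 (exec_instr i c).2).
Proof.
move=> Pm; have iK := reg_lt Pm.
have mP : m < size P by rewrite -onthTE Pm.
have X0 : conf K k m c ⊑ fcol0 by apply: le_trans (conf_here _ _ _) (le_andl _ _ _ _).
have Xh : conf K k m c ⊑ here k m by apply: le_trans (conf_here _ _ _) (le_andr _ _ _ _).
have Xn r : r < K -> conf K k m c ⊑ here k m ⊓ num r (c r).
  by move=> rK; apply: le_and => //; exact: conf_num.
have rule L R : (L, R) \in instr_rules K k i -> conf K k m c ⊑ L ->
    conf K k m c ⊑ (fS ⇒ stuck k ⊔ R).
  move=> LR XL; apply: (@le_trans _ _ (here k m ⊓ L)); first exact: le_and.
  exact: le_S_rule LR.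
have ctl l : fcol0 ⊓ (fx (~~ k) ⊓ fq l) ⊑ fx (~~ k) by exact/le_andrt/le_andl.
have idle r : r < K -> r != reg i ->
    conf K k m c ⊑ (fS ⇒ unless_stuck k r (c r) (num r 0)).
  move=> rK ri.
  have rule_idle LR : LR \in idle_rules r -> LR \in instr_rules K k i.
    move=> LRr; rewrite /instr_rules !mem_cat; do 2 (apply/orP; right).
    by apply/flatten_mapP; exists r => //; rewrite mem_filter ri mem_iota.
  have rz : (fz r, fz r) \in instr_rules K k i.
    by apply: rule_idle; rewrite !inE eqxx.
  have rb : (fb r, fb r) \in instr_rules K k i.
    by apply: rule_idle; rewrite !inE eqxx orbT.
  apply: le_trans (Xn r rK) _; apply: num_from_S => //.
  - exact: le_rule_S rz.
  - exact: le_S_rule rz.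
  - move=> n; apply: le_imp (le_rule_S Pm rb) _ (le_refl _ _ _).
    by apply: le_and2; [exact: le_refl | exact: le_andl].
  - move=> n; apply: le_trans (le_S_rule Pm rb).
    by apply: le_and2; [exact: le_refl | exact: le_andl].
case: i => [r l|r lz ls] in Pm iK rule idle *.
  have Xctl : conf K k m c ⊑ (fS ⇒ stuck k ⊔ fcol0 ⊓ (fx (~~ k) ⊓ fq l)).
    by apply: rule X0; rewrite inE eqxx.
  apply: le_conf => //= r' r'K; rewrite /upd; case: eqP => [->|/eqP r'r].
    rewrite -[(c r).+1]addn1; apply: (unless_stuck_num iK (ctl l)) => //.
    have rz : (fz r, fb r ⊓ next_col (fz r))%F \in instr_rules K k (IInc r l).
      by rewrite !inE eqxx ?orbT.
    have rb : (fb r, fb r) \in instr_rules K k (IInc r l).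
      by rewrite !inE eqxx ?orbT.
    apply: le_trans (Xn r iK) _; apply: num_from_S => //.
    - exact: le_rule_S rz.
    - exact: le_S_rule rz.
    - move=> n; apply: le_imp (le_rule_S Pm rb) _ (le_refl _ _ _).
      by apply: le_and2; [exact: le_refl | exact: le_andl].
    - move=> n; apply: le_trans (le_S_rule Pm rb).
      by apply: le_and2; [exact: le_refl | exact: le_andl].
  by rewrite -[c r']addn0; apply: (unless_stuck_num r'K (ctl l)) => //; exact: idle.
case cr: (c r) => [|n] /=; rewrite cr /=.
  have Xz : conf K k m c ⊑ fcol0 ⊓ fz r.
    by apply: le_and => //; move: (conf_num k m c iK); rewrite /= cr.
  have Xctl : conf K k m c ⊑ (fS ⇒ stuck k ⊔ fcol0 ⊓ (fx (~~ k) ⊓ fq lz)).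
    by apply: rule Xz; rewrite inE eqxx.
  apply: le_conf => //= r' r'K; case: (eqVneq r' r) => [->|r'r].
    by rewrite cr; apply: rule Xz; rewrite !inE eqxx !orbT.
  by rewrite -[c r']addn0; apply: (unless_stuck_num r'K (ctl lz)) => //; exact: idle.
have Xb : conf K k m c ⊑ fcol0 ⊓ fb r.
  apply: le_and => //; apply: le_trans (conf_num k m c iK) _.
  by rewrite /= cr; exact: le_andl.
have Xctl : conf K k m c ⊑ (fS ⇒ stuck k ⊔ fcol0 ⊓ (fx (~~ k) ⊓ fq ls)).
  by apply: rule Xb; rewrite !inE eqxx !orbT.
apply: le_conf => //= r' r'K; rewrite /upd; case: eqP => [->|/eqP r'r].
  rewrite -[n]addn0; apply: (unless_stuck_num iK (ctl ls)) => //.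
  have rz : (fb r ⊓ next_col (fz r), fz r)%F \in instr_rules K k (IDec r lz ls).
    by rewrite !inE eqxx ?orbT.
  have rb : (fb r ⊓ next_col (fb r), fb r)%F \in instr_rules K k (IDec r lz ls).
    by rewrite !inE eqxx ?orbT.
  (* The display of [n.+1] ends in [num r 1], a cell followed by the mark, which [rz] shrinks to the
     mark; every earlier cell is followed by another cell, as [rb] demands. *)
  have bb n' : here k m ⊓ num_from r n'.+1 (num r 1) ⊑
               here k m ⊓ (fb r ⊓ next_col (fb r)).
    apply: le_and2; first exact: le_refl.
    by apply: le_and2; [exact: le_refl | apply: next_mono; exact: num_ge_b].
  apply: le_trans (Xn r iK) _; rewrite cr (_ : num r n.+1 = num_from r n (num r 1)).
    2: by rewrite num_fromE addn1.
  apply: num_from_S => //.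
  - exact: le_rule_S rz.
  - exact: le_S_rule rz.
  - by move=> n'; apply: le_imp (le_rule_S Pm rb) (bb n') (le_refl _ _ _).
  - by move=> n'; apply: le_trans (bb n') (le_S_rule Pm rb).
by rewrite -[c r']addn0; apply: (unless_stuck_num r'K (ctl ls)) => //; exact: idle.
Qed.

(** Absurdity of the final configuration propagates backwards in time, the row parity
    alternating. *)
Lemma conf_halts t k s : (iter t (step P) s).1 = size P ->
  conf K k s.1 s.2 ⊑ fbot.
Proof.
elim: t k s => [|t IH] k s.
  move=> /= ->; apply: le_trans (conf_here _ _ _) _; do 2 apply: le_andrt.
  by apply: le_base; rewrite !inE eqxx !orbT.
rewrite iterSr => halt; case Ps: (onth P s.1) => [i|]; last first.
  by apply: IH; move: halt; rewrite /step Ps.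
have := IH (~~ k) (exec_instr i s.2); move: halt; rewrite /step Ps => halt {}IH.
have {}IH := IH halt.
(* The next configuration being absurd, only [stuck k] is left, contrary to the progress axiom. *)
apply: (@le_trans _ _ (fx k ⊓ (fS ⇒ stuck k))); last first.
  by apply: (@le_grid k); rewrite !inE eqxx !orbT.
apply: le_and.
  apply: le_trans (conf_here _ _ _) _; apply: le_andrt; exact: le_andl.
apply: le_imp (conf_step _ _ Ps) (le_refl _ _ _) _.
apply: le_or; first exact: le_refl.
exact: le_trans IH (bot_stuck _).
Qed.

Lemma start_conf n : fstart ⊓ num 0 n ⊑ conf K false l0 (upd (fun=> 0) 0 n).
Proof.
rewrite /conf; have : {subset iota 0 K <= gtn K} by move=> r; rewrite mem_iota.
elim: (iota 0 K) => [|r s IH] /= sK.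
  by apply: le_andlt; apply: le_base; rewrite !inE eqxx !orbT.
apply: le_and; last by apply: IH => r' r's; apply: sK; rewrite inE r's orbT.
rewrite /upd; case: eqP => [->|/eqP r0]; first exact: le_andr.
apply: le_andlt; apply: le_start_z.
have : r \in gtn K by apply: sK; rewrite inE eqxx.
by rewrite inE; lia.
Qed.

Theorem halting_derivable n t :
  (iter t (step P) (l0, upd (fun=> 0) 0 n)).1 = size P ->
  TWJp (halting_formula P l0 n).
Proof.
move=> halt; have := le_trans (start_conf n) (conf_halts false halt).
(* With letters up to 13 only, the goal is unchanged by clamping. *)
have num_le : maxvar (num 0 n) <= 13.
  by elim: n {halt} => //= n IH; rewrite !geq_max /= IH.
have le_bound A : maxvar A <= 13 -> maxvar A <= theory_bound 13 (axioms P l0).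
  by move=> /leq_trans; apply; exact: leq_maxl.
by rewrite /entails !clamp_id // le_bound //= geq_max num_le.
Qed.

End Derivation.

(** * A model on finite sets following an infinite run *)

Local Open Scope fset_scope.
Local Open Scope nat_scope.

Definition row (u : {fset nat}) (t : nat) := forall m, (m.*2 \in u) = (m < t).
Definition col (u : {fset nat}) (i : nat) := forall m, (m.*2.+1 \in u) = (m < i).

Lemma row_inj u t t' : row u t -> row u t' -> t = t'.
Proof. by move=> ut ut'; have := ut t'; have := ut' t; rewrite ut ut'; lia. Qed.

Lemma col_inj u i i' : col u i -> col u i' -> i = i'.
Proof. by move=> ui ui'; have := ui i'; have := ui' i; rewrite ui ui'; lia. Qed.

Lemma row_even u t i : row (u `|` [fset i.*2.+1]) t <-> row u t.
Proof.
have E m : (m.*2 \in u `|` [fset i.*2.+1]) = (m.*2 \in u).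
  by rewrite !inE (_ : (_ == _) = false) ?orbF //; lia.
by split=> ut m; have := ut m; rewrite E.
Qed.

Lemma col_odd u t i : col (u `|` [fset t.*2]) i <-> col u i.
Proof.
have E m : (m.*2.+1 \in u `|` [fset t.*2]) = (m.*2.+1 \in u).
  by rewrite !inE (_ : (_ == _) = false) ?orbF //; lia.
by split=> ut m; have := ut m; rewrite E.
Qed.

Lemma row_next u t : row u t -> row (u `|` [fset t.*2]) t.+1.
Proof. by move=> ut m; rewrite !inE ut; lia. Qed.

Lemma col_next u i : col u i -> col (u `|` [fset i.*2.+1]) i.+1.
Proof. by move=> ui m; rewrite !inE ui; lia. Qed.

Lemma row_add u t t' t'' : row u t -> row (u `|` [fset t'.*2]) t'' ->
  t'' = t \/ t' = t /\ t'' = t.+1.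
Proof.
move=> ut ut''; have E m : (m < t'') = (m < t) || (m == t').
  by rewrite -ut'' !inE ut; congr (_ || _); lia.
by have := E t'; have := E t; have := E t''; have := E t.+1; lia.
Qed.

Lemma col_add u i i' i'' : col u i -> col (u `|` [fset i'.*2.+1]) i'' ->
  i'' = i \/ i' = i /\ i'' = i.+1.
Proof.
move=> ui ui''; have E m : (m < i'') = (m < i) || (m == i').
  by rewrite -ui'' !inE ui; congr (_ || _); lia.
by have := E i'; have := E i; have := E i''; have := E i.+1; lia.
Qed.

Lemma forces_theory V N Ax : (forall A, A \in Ax -> forces V fset0 A) ->
  forces V fset0 (theory N Ax).
Proof.
move=> AxV; rewrite /theory.
have : forall A,
    A \in Ax ++ [seq (Var p ⇒ Var p)%F | p <- iota 0 (theory_bound N Ax).+1] ->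
    forces V fset0 A.
  move=> A; rewrite mem_cat => /orP[/AxV //|/mapP[p _ ->]] /= y.
  by rewrite fset0U.
elim: (_ ++ _) => [_ y|A l IH lV] /=; first by rewrite fset0U.
split; first by apply: lV; rewrite inE eqxx.
by apply: IH => B Bl; apply: lV; rewrite inE Bl orbT.
Qed.

Section Model.

Variables (P : seq instr) (l0 n : nat) (run : nat -> config).
Hypotheses (run0 : run 0 = (l0, upd (fun=> 0) 0 n))
  (runS : forall t, run t.+1 = step P (run t))
  (live : forall t, (run t).1 < size P).

(** Letters from 11 on are read modulo 3, matching the numbering of [fq], [fb] and [fz]; the row of
    the set is the time at which the run is consulted. *)
Definition grid_val (p : nat) (u : {fset nat}) : Prop :=
  match p with
  | 0 => False
  | 1 => exists t, u = [fset t.*2]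
  | 2 => exists i, u = [fset i.*2.+1]
  | 3 => row u 0 /\ col u 0
  | 4 => col u 0
  | 5 => ~ exists t, row u t
  | 6 => ~ exists i, col u i
  | 7 => exists2 t, row u t & ~~ odd t
  | 8 => exists2 t, row u t & odd t
  | 9 => exists2 i, col u i & ~~ odd i
  | 10 => exists2 i, col u i & odd i
  | p'.+4.+4.+3 => exists2 t, row u t &
      match p' %% 3 with
      | 0 => (run t).1 = p' %/ 3
      | 1 => exists2 i, col u i & i < (run t).2 (p' %/ 3)
      | _ => col u ((run t).2 (p' %/ 3))
      end
  end.

Local Notation "u ⊩ A" := (forces grid_val u A%F) (at level 70).

Lemma forces_imp0 A B : (forall u, u ⊩ A -> u ⊩ B) -> fset0 ⊩ (A ⇒ B).
Proof. by move=> AB u /=; rewrite fset0U; exact: AB. Qed.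

Lemma forces_fS u A : u ⊩ (fS ⇒ A) <-> forall t, u `|` [fset t.*2] ⊩ A.
Proof. by split=> [H t|H y [t ->] //]; apply: H; exists t. Qed.

Lemma forces_fA u A : u ⊩ (fA ⇒ A) <-> forall i, u `|` [fset i.*2.+1] ⊩ A.
Proof. by split=> [H t|H y [t ->] //]; apply: H; exists t. Qed.

Lemma forces_x u k : u ⊩ fx k <-> exists2 t, row u t & odd t = k.
Proof. by case: k; split=> -[t ut /=] odd_t; exists t => //; case: odd odd_t. Qed.

Lemma forces_y u k : u ⊩ fy k <-> exists2 i, col u i & odd i = k.
Proof. by case: k; split=> -[t ut /=] odd_t; exists t => //; case: odd odd_t. Qed.

Lemma forces_q u l : u ⊩ fq l <-> exists2 t, row u t & (run t).1 = l.
Proof.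
rewrite /= (_ : 3 * l %% 3 = 0); last by lia.
by rewrite (_ : 3 * l %/ 3 = l); last lia.
Qed.

Lemma forces_b u r : u ⊩ fb r <->
  exists2 t, row u t & exists2 i, col u i & i < (run t).2 r.
Proof.
rewrite /= (_ : (3 * r).+1 %% 3 = 1); last by lia.
by rewrite (_ : (3 * r).+1 %/ 3 = r); last lia.
Qed.

Lemma forces_z u r : u ⊩ fz r <-> exists2 t, row u t & col u ((run t).2 r).
Proof.
rewrite /= (_ : (3 * r).+2 %% 3 = 2); last by lia.
by rewrite (_ : (3 * r).+2 %/ 3 = r); last lia.
Qed.

Lemma forces_next u E : u ⊩ next_col E <->
  exists2 i, col u i & u `|` [fset i.*2.+1] ⊩ E.
Proof.
have side k : u ⊩ (fy k ⊓ (fA ⇒ (ybad ⊔ fy k) ⊔ E)) <->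
    exists2 i, col u i /\ odd i = k & u `|` [fset i.*2.+1] ⊩ E.
  split=> [[/forces_y[i ui ik] uA]|[i [ui ik] uE]].
    have H := proj1 (forces_fA u ((ybad ⊔ fy k) ⊔ E)) uA.
    exists i => //; case: (H i) => // -[]; first by case; exists i.+1; exact: col_next.
    by case/forces_y=> i' /(col_inj (col_next ui)) <-; rewrite /= ik; case: (k).
  split; first by apply/forces_y; exists i.
  (* If the enlarged set still has a column, it is the old one, of parity [k], or the next one,
     where [E] is given. *)
  apply/forces_fA => i'; case: (classic (exists j, col (u `|` [fset i'.*2.+1]) j))
    => [[j uj]|no_col].
    case: (col_add ui uj) => [ji|[-> _]]; last by right.
    by left; right; apply/forces_y; exists j => //; rewrite ji.
  by left; left.
split=> [[/side|/side] [i [ui _] uE]|[i ui uE]]; try by exists i.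
by case ik: (odd i); [right | left]; apply/side; exists i.
Qed.

Lemma row_b u t r : row u t ->
  u ⊩ fb r <-> exists2 i, col u i & i < (run t).2 r.
Proof.
move=> ut; split=> [/forces_b[t' /(row_inj ut) <-] //|ur].
by apply/forces_b; exists t.
Qed.

Lemma row_z u t r : row u t -> u ⊩ fz r <-> col u ((run t).2 r).
Proof.
move=> ut; split=> [/forces_z[t' /(row_inj ut) <-] //|ur].
by apply/forces_z; exists t.
Qed.

Lemma row_next_b u t r : row u t ->
  u ⊩ next_col (fb r) <-> exists2 i, col u i & i.+1 < (run t).2 r.
Proof.
move=> ut; split=> [/forces_next[i ui]|[i ui ir]].
  have ut' : row (u `|` [fset i.*2.+1]) t by apply/row_even.
  by move/(row_b _ ut') => [j /(col_inj (col_next ui)) <-]; exists i.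
apply/forces_next; exists i => //; apply/(@row_b _ t); first exact/row_even.
by exists i.+1 => //; exact: col_next.
Qed.

Lemma row_next_z u t r : row u t ->
  u ⊩ next_col (fz r) <-> exists2 i, col u i & i.+1 = (run t).2 r.
Proof.
move=> ut; split=> [/forces_next[i ui]|[i ui ir]].
  have ut' : row (u `|` [fset i.*2.+1]) t by apply/row_even.
  by move/(row_z _ ut') => /(col_inj (col_next ui)) <-; exists i.
apply/forces_next; exists i => //; apply/(@row_z _ t); first exact/row_even.
by rewrite -ir; exact: col_next.
Qed.

Lemma forces_here u k l : u ⊩ here k l ->
  exists t, [/\ row u t, odd t = k & (run t).1 = l].
Proof.
case=> /forces_x[t ut tk] /forces_q[t' /(row_inj ut) <- tl].
by exists t.
Qed.

Lemma run_step t i : onth P (run t).1 = Some i ->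
  run t.+1 = exec_instr i (run t).2.
Proof. by rewrite runS /step => ->. Qed.

Lemma control_sound k i L R u t : onth P (run t).1 = Some i ->
  (L, R) \in control_rules k i -> row u t -> odd t = k -> u ⊩ L ->
  u `|` [fset t.*2] ⊩ R.
Proof.
move=> /run_step run_t LR ut tk; have vt := row_next ut.
have vx : u `|` [fset t.*2] ⊩ fx (~~ k).
  by apply/forces_x; exists t.+1 => //=; rewrite tk.
have vq : u `|` [fset t.*2] ⊩ fq (exec_instr i (run t).2).1.
  by apply/forces_q; exists t.+1; rewrite ?run_t.
case: i => [r l|r lz ls] /= in run_t LR vq *; move: LR; rewrite !inE.
  by move=> /eqP[-> ->] u0; split=> //; apply/col_odd.
case/or3P=> /eqP[-> ->]; case=> u0; have {}u0 := proj2 (col_odd u t 0) u0.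
- move=> /(row_z _ ut) /(col_inj (proj1 (col_odd u t 0) u0)) r0.
  by rewrite -r0 in vq.
- move=> /(row_z _ ut) /(col_inj (proj1 (col_odd u t 0) u0)) r0.
  by apply/(row_z _ vt); rewrite run_t -r0 /= -r0.
- move=> /(row_b _ ut) [i /(col_inj (proj1 (col_odd u t 0) u0)) <- r0].
  by rewrite eqn0Ngt r0 in vq.
Qed.

Lemma active_sound i L R u t : onth P (run t).1 = Some i ->
  (L, R) \in active_rules i -> row u t -> u ⊩ L ->
  u `|` [fset t.*2] ⊩ R.
Proof.
move=> /run_step run_t LR ut; have vt := row_next ut.
case: i => [r l|r lz ls] /= in run_t LR *; move: LR; rewrite !inE.
  case/orP=> /eqP[-> ->].
    move/(row_z _ ut) => /col_odd ur; split.
      apply/(row_b _ vt); exists ((run t).2 r) => //.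
      by rewrite run_t /= /upd eqxx.
    apply/(row_next_z _ vt); exists ((run t).2 r) => //.
    by rewrite run_t /= /upd eqxx.
  move/(row_b _ ut) => [j /col_odd uj jr]; apply/(row_b _ vt); exists j => //.
  by rewrite run_t /= /upd eqxx ltnW.
case/orP=> /eqP[-> ->] [_].
  move/(row_next_z _ ut) => [j /col_odd uj jr]; apply/(row_z _ vt).
  by rewrite run_t /= -jr /= /upd eqxx.
move/(row_next_b _ ut) => [j /col_odd uj jr]; apply/(row_b _ vt); exists j => //.
by rewrite run_t; case: eqP => /= [|_]; rewrite /upd ?eqxx; lia.
Qed.

Lemma idle_sound i r L R u t : onth P (run t).1 = Some i -> r != reg i ->
  (L, R) \in idle_rules r -> row u t -> u ⊩ L ->
  u `|` [fset t.*2] ⊩ R.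
Proof.
move=> /run_step run_t ri LR ut; have vt := row_next ut.
have r_run : (run t.+1).2 r = (run t).2 r.
  rewrite run_t; case: i {run_t} ri => [r' l|r' lz ls] /= /negbTE ri.
    by rewrite /upd ri.
  by case: eqP => //= _; rewrite /upd ri.
move: LR; rewrite !inE => /orP[] /eqP[-> ->].
  by move/(row_z _ ut) => /col_odd ur; apply/(row_z _ vt); rewrite r_run.
move/(row_b _ ut) => [j /col_odd uj jr]; apply/(row_b _ vt); exists j => //.
by rewrite r_run.
Qed.

Lemma rule_sound K k i L R u t : onth P (run t).1 = Some i ->
  (L, R) \in instr_rules K k i -> row u t -> odd t = k -> u ⊩ L ->
  u `|` [fset t.*2] ⊩ R.
Proof.
move=> Pt; rewrite /instr_rules !mem_cat => /or3P[LR|LR|].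
- exact: control_sound LR.
- by move=> ut _; exact: active_sound LR ut.
case/flatten_mapP=> r; rewrite mem_filter => /andP[ri _] LR ut _.
exact: idle_sound Pt ri LR ut.
Qed.

(** Only the singleton with [s = t] advances row [t], and there the rule applies; any other breaks
    the row or leaves it, both being [stuck k]. *)
Lemma stuck_or K k m i L R u s : onth P m = Some i ->
  (L, R) \in instr_rules K k i -> u ⊩ here k m -> u ⊩ L ->
  u `|` [fset s.*2] ⊩ (stuck k ⊔ R).
Proof.
move=> Pm LR /forces_here[t [ut tk tm]] uL.
case: (classic (exists t', row (u `|` [fset s.*2]) t')) => [[t' vt']|]; last first.
  by left; left.
case: (row_add ut vt') => [t't|[-> _]]; last first.
  by right; apply: rule_sound LR ut tk uL; rewrite tm.
by left; right; apply/forces_x; exists t' => //; rewrite t't.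
Qed.

Lemma rule_axioms_sound K k m i LR A : onth P m = Some i ->
  LR \in instr_rules K k i -> A \in rule_axioms k m LR -> fset0 ⊩ A.
Proof.
case: LR => L R Pm LR; rewrite !inE => /orP[] /eqP-> /= y.
  case=> t -> u [uh uL]; rewrite fset0U fsetUC; exact: stuck_or LR uh uL.
by move=> [uh uL] v [t ->]; rewrite fset0U; exact: stuck_or LR uh uL.
Qed.

Lemma grid_sound k A : A \in grid_axioms k -> fset0 ⊩ A.
Proof.
rewrite !inE => /or4P[||| /orP[]] /eqP->; apply: forces_imp0 => u.
- case=> /forces_x[t ut tk] [[]|]; first by exists t.
  by move=> /forces_x[t' /(row_inj ut) <-]; rewrite tk; case: (k).
- case/forces_x=> t ut tk; apply/forces_fA => i; apply/forces_x.
  by exists t => //; apply/row_even.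
- case=> t -> v; rewrite fsetUC => /forces_y[i vi ik].
  by apply/forces_y; exists i => //; apply/col_odd.
- case/forces_y=> i ui ik; apply/forces_fS => t; apply/forces_y.
  by exists i => //; apply/col_odd.
case=> /forces_x[t ut tk] uS.
have := proj1 (forces_fS u (stuck k)) uS t; have vt := row_next ut.
case=> [[]|]; first by exists t.+1.
by move=> /forces_x[t' /(row_inj vt) <-] /=; rewrite tk; case: (k).
Qed.

Lemma axioms_sound A : A \in axioms P l0 -> fset0 ⊩ A.
Proof.
rewrite /axioms mem_cat => /orP[|].
  rewrite !inE => /or4P[||| /or3P[]] /eqP->; apply: forces_imp0 => u //.
  - case=> t -> v /= vn; case=> i; rewrite fsetUC => /col_odd vi.
    by apply: vn; exists i.
  - by case/forces_q=> t ut tP; have := live t; rewrite tP ltnn.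
  - case=> ut ui; split=> //; split; first by apply/forces_x; exists 0.
    by apply/forces_q; exists 0; rewrite ?run0.
rewrite !mem_cat => /or4P[/mapP[r]|/mapP[r _ ->] //|/mapP[r _ ->] //|].
  rewrite mem_iota => r0 ->; apply: forces_imp0 => u [ut ui].
  apply/(row_z _ ut); by rewrite run0 /= /upd; case: eqP r0 => // ->.
case/or3P=> [/mapP[m _ ->]|/or3P[||//]|/flattenP[s /allpairsP[[k m] /= [_ mP ->]]]].
  apply: forces_imp0 => u /forces_q[t ut tm]; apply/forces_fA => i; apply/forces_q.
  by exists t => //; apply/row_even.
1,2: exact: grid_sound.
case Pm: (onth P m) => [i|] //= /flatten_mapP[LR]; exact: rule_axioms_sound.
Qed.

Lemma num_forced e u t i : row u t -> col u i -> (run t).2 0 = i + e -> u ⊩ num 0 e.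
Proof.
elim: e u i => [|e IH] u i ut ui ie.
  by apply/(row_z _ ut); rewrite ie addn0.
split; first by apply/(row_b _ ut); exists i => //; rewrite ie; lia.
apply/forces_next; exists i => //; apply: (IH _ i.+1); last by rewrite ie; lia.
  exact/row_even.
exact: col_next.
Qed.

(** The empty set lies in row 0 and column 0 and displays the input there, while [fbot] is forced
    nowhere. *)
Theorem nonhalting_refuted : ~ LogPfin (halting_formula P l0 n).
Proof.
move=> /(_ grid_val fset0 (forces_theory _ axioms_sound)).
have row0 : row fset0 0 by [].
have col0 : col fset0 0 by [].
rewrite fset0U => /(_ fset0) /=; apply; split=> //.
by apply: (num_forced row0 col0); rewrite run0.
Qed.

End Model.

(** * Recursive functions on register machines *)

Inductive cmd := Nop | Inc of nat | Seq of cmd & cmd | Loop of nat & cmd.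

Inductive exec : cmd -> (nat -> nat) -> (nat -> nat) -> Prop :=
| exec_nop s : exec Nop s s
| exec_inc r s : exec (Inc r) s (upd s r (s r).+1)
| exec_seq c d s s' s'' : exec c s s' -> exec d s' s'' -> exec (Seq c d) s s''
| exec_loop0 r c s : s r = 0 -> exec (Loop r c) s s
| exec_loopS r c s s' s'' : s r <> 0 -> exec c (upd s r (s r).-1) s' ->
    exec (Loop r c) s' s'' -> exec (Loop r c) s s''.

(* Code placed at address [a] and exiting to address [k], with its entry point. *)
Fixpoint flat (c : cmd) (a k : nat) : nat * seq instr :=
  match c with
  | Nop => (k, [::])
  | Inc r => (a, [:: IInc r k])
  | Seq c d =>
      let D := flat d a k in
      let C := flat c (a + size D.2) D.1 in (C.1, D.2 ++ C.2)
  | Loop r c => let C := flat c a.+1 a in (a, IDec r k C.1 :: C.2)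
  end.

Definition reach P (s s' : config) := exists t, iter t (step P) s = s'.

Lemma reach_refl P s : reach P s s. Proof. by exists 0. Qed.

Lemma reach_trans P s s' s'' : reach P s s' -> reach P s' s'' -> reach P s s''.
Proof. by case=> t <- [t' <-]; exists (t' + t); rewrite iterD. Qed.

Lemma reach_step P s s' : step P s = s' -> reach P s s'.
Proof. by exists 1. Qed.

(** The surrounding code [L] and [R] is arbitrary so that the induction reaches subprograms. A loop
    body exits to its own loop test. *)
Lemma flat_reach c s s' : exec c s s' -> forall L R a k, size L = a ->
  reach (L ++ (flat c a k).2 ++ R) ((flat c a k).1, s) (k, s').
Proof.
elim=> {c s s'} [s|r s|c d s s' s'' _ IHc _ IHd|r c s r0|r c s s' s'' r0 _ IHc _ IHl]
  L R a k La /=.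
- exact: reach_refl.
- apply: reach_step; by rewrite /step -La /= onth_cat ltnn subnn.
- apply: (@reach_trans _ _ ((flat d a k).1, s')); last by rewrite -catA; apply: IHd.
  have := IHc (L ++ (flat d a k).2) R _ (flat d a k).1 (erefl _).
  by rewrite -!catA size_cat La.
- apply: reach_step; rewrite /step -La /= onth_cat ltnn subnn /= r0 //.
- apply: (@reach_trans _ _ ((flat c a.+1 a).1, upd s r (s r).-1)).
    apply: reach_step; rewrite /step -La /= onth_cat ltnn subnn /=.
    by move/eqP: r0 => /negbTE ->.
  apply: reach_trans (IHl L R a k La); rewrite -cat_rcons.
  by apply: IHc; rewrite size_rcons La.
Qed.

Definition clear r := Loop r Nop.

Lemma exec_clear r s : exists2 s', exec (clear r) s s' & s' =1 upd s r 0.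
Proof.
move sr : (s r) => n; elim: n s sr => [|n IH] s sr.
  by exists s; [exact: exec_loop0 | move=> x; rewrite /upd; case: eqP => // ->].
have [|s' ex s'E] := IH (upd s r n); first by rewrite /upd eqxx.
exists s'; last by move=> x; rewrite s'E /upd; case: eqP.
by apply: exec_loopS ex; rewrite sr //; exact: exec_nop.
Qed.

(** Reading a register destroys it, so [t] receives a second copy from which [a] is refilled. *)
Definition copy a b t :=
  Seq (Seq (clear b) (clear t))
      (Seq (Loop a (Seq (Inc b) (Inc t))) (Loop t (Inc a))).

Lemma exec_copy a b t s : a != b -> a != t -> b != t ->
  exists2 s', exec (copy a b t) s s' & s' =1 upd (upd s b (s a)) t 0.
Proof.
move=> ab at_ bt.
have [s1 ex1 s1E] := exec_clear b s; have [s2 ex2 s2E] := exec_clear t s1.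
have fan n s' : s' a = n -> exists2 s'', exec (Loop a (Seq (Inc b) (Inc t))) s' s'' &
    forall x, s'' x = if x == a then 0 else
                      if (x == b) || (x == t) then s' x + n else s' x.
  elim: n s' => [|n IH] s' s'a.
    exists s'; first exact: exec_loop0.
    by move=> x; case: eqP => [->//|_]; rewrite addn0 if_same.
  set s3 := upd s' a n; set s4 := upd s3 b (s3 b).+1; set s5 := upd s4 t (s4 t).+1.
  have [|s'' ex s''E] := IH s5.
    by rewrite /s5 /s4 /s3 /upd (negbTE at_) (negbTE ab) eqxx.
  exists s''.
    apply: exec_loopS ex; rewrite s'a //=.
    by apply: exec_seq; exact: exec_inc.
  move=> x; rewrite s''E /s5 /s4 /s3 /upd; case: (eqVneq x a) => // _.
  case: (eqVneq x b) => [->|xb] /=.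
    by rewrite (negbTE bt) eq_sym (negbTE ab) addnS.
  case: (eqVneq x t) => [->|//].
  by rewrite [t == b]eq_sym (negbTE bt) [t == a]eq_sym (negbTE at_) addnS.
have back n s' : s' t = n -> exists2 s'', exec (Loop t (Inc a)) s' s'' &
    forall x, s'' x = if x == t then 0 else if x == a then s' a + n else s' x.
  elim: n s' => [|n IH] s' s't.
    exists s'; first exact: exec_loop0.
    by move=> x; case: eqP => [->//|_]; rewrite addn0; case: eqP => // ->.
  set s3 := upd s' t n; set s4 := upd s3 a (s3 a).+1.
  have [|s'' ex s''E] := IH s4.
    by rewrite /s4 /s3 /upd eq_sym (negbTE at_) eqxx.
  exists s''; first by apply: exec_loopS ex; rewrite s't //=; exact: exec_inc.
  move=> x; rewrite s''E /s4 /s3 /upd eqxx (negbTE at_) addnS.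
  by case: (x == t); case: (x == a).
have [|s3 ex3 s3E] := fan (s a) s2.
  by rewrite s2E /upd (negbTE at_) s1E /upd (negbTE ab).
have [|s4 ex4 s4E] := back (s a) s3.
  by rewrite s3E eqxx orbT s2E /upd eqxx eq_sym (negbTE at_).
exists s4.
  by apply: exec_seq (exec_seq ex1 ex2) (exec_seq ex3 ex4).
move=> x; rewrite s4E !s3E !s2E /upd eqxx !s1E /upd.
case: (eqVneq x t) => // xt; case: (eqVneq x a) => [->|xa].
  by rewrite (negbTE ab).
by case: (eqVneq x b).
Qed.

(* The value of [f] at the registers [args], all below [m], is put in register
   [m]; the registers above [m] are scratch. *)
Fixpoint compile n (f : recfun n) (args : seq nat) (m : nat) : cmd :=
  match f with
  | Rzero _ => clear m
  | Rsucc => Seq (copy (head 0 args) m m.+1) (Inc m)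
  | Rproj _ i => copy (nth 0 args i) m m.+1
  | Rcomp k _ h g =>
      Seq (foldr (fun i c => Seq (compile (g i) args (m.+1 + i)) c) Nop (enum 'I_k))
          (Seq (compile h (iota m.+1 k) (m.+1 + k)) (copy (m.+1 + k) m (m.+2 + k)))
  | Rprec _ h g =>
      Seq (Seq (compile h (behead args) m.+3) (copy m.+3 m m.+4))
      (Seq (Seq (clear m.+1) (copy (head 0 args) m.+2 m.+3))
           (Loop m.+2 (Seq (compile g [:: m.+1, m & behead args] m.+3)
                           (Seq (copy m.+3 m m.+4) (Inc m.+1)))))
  | Rmin _ h =>
      let test := Seq (compile h (m :: args) m.+2) (copy m.+2 m.+1 m.+3) in
      Seq (Seq (clear m) test) (Loop m.+1 (Seq (clear m.+1) (Seq (Inc m) test)))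
  end.

Definition ret (m y : nat) (s s' : nat -> nat) :=
  s' m = y /\ forall r, r < m -> s' r = s r.

Definition compiles n (f : recfun n) :=
  forall (v : n.-tuple nat) y, computes f v y -> forall s args m,
  all (gtn m) args -> map s args = v ->
  exists2 s', exec (compile f args m) s s' & ret m y s s'.

Lemma map_ext_lt (s s' : nat -> nat) m args : all (gtn m) args ->
  (forall r, r < m -> s' r = s r) -> map s' args = map s args.
Proof. by move=> /allP lt ss'; apply/eq_in_map => r /lt; exact: ss'. Qed.

Lemma compile_comp k n (h : recfun k) (g : 'I_k -> recfun n) :
  compiles h -> (forall i, compiles (g i)) -> compiles (Rcomp h g).
Proof.
move=> Ch Cg v y /= [w [gw hw]] s args m lt_m args_v.
have [s1 ex1 [s1w s1lt]] : exists2 s1,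
    exec (foldr (fun i c => Seq (compile (g i) args (m.+1 + i)) c) Nop (enum 'I_k))
         s s1 &
    (forall i : 'I_k, s1 (m.+1 + i) = tnth w i) /\ (forall r, r <= m -> s1 r = s r).
  (* [l] lists the indices from [j] on. Each [g i] writes above the results already stored, so these
     and the arguments survive. *)
  have go : forall l (j : nat) s0, map val l = iota j (k - j) -> j <= k ->
      (forall r, r <= m -> s0 r = s r) ->
      (forall i : 'I_k, i < j -> s0 (m.+1 + i) = tnth w i) ->
      exists2 s1,
        exec (foldr (fun i c => Seq (compile (g i) args (m.+1 + i)) c) Nop l) s0 s1 &
      (forall i : 'I_k, s1 (m.+1 + i) = tnth w i) /\ (forall r, r <= m -> s1 r = s r).
    elim=> [|i l IH] j s0 /= lj jk s0lt s0w.
      exists s0; first exact: exec_nop.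
      split=> // i; apply: s0w; have := ltn_ord i.
      by have := congr1 size lj; rewrite size_iota /=; lia.
    case kj: (k - j) lj => [//|p] /= [ij lj].
    have [||s0' ex0 [s0'i s0'lt]] := Cg i v _ (gw i) s0 args (m.+1 + i).
      by apply: sub_all lt_m => r /=; lia.
      rewrite -args_v; apply: map_ext_lt lt_m _ => r rm; apply: s0lt; exact: ltnW.
    have [||||s1 ex1 s1P] := IH j.+1 s0'.
    - by rewrite lj; congr iota; lia.
    - by lia.
    - by move=> r rm; rewrite s0'lt ?s0lt //; lia.
    - move=> i'; rewrite ltnS leq_eqVlt => /orP[/eqP i'j|i'j].
        by have -> : i' = i by [apply: val_inj; rewrite /= ij i'j]; rewrite s0'i.
      by rewrite s0'lt ?s0w //; lia.
    by exists s1 => //; exact: exec_seq ex0 ex1.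
  by apply: (go _ 0) => //; rewrite val_enum_ord subn0.
have [||s2 ex2 [s2y s2lt]] := Ch w _ hw s1 (iota m.+1 k) (m.+1 + k).
- by apply/allP => r; rewrite mem_iota /=; lia.
- apply: (@eq_from_nth _ 0); first by rewrite size_map size_iota size_tuple.
  move=> i; rewrite size_map size_iota => ik.
  rewrite (nth_map 0) ?size_iota // nth_iota //.
  by have := s1w (Ordinal ik); rewrite (tnth_nth 0).
have [||| s3 ex3 s3E] := @exec_copy (m.+1 + k) m (m.+2 + k) s2; try lia.
exists s3; first by apply: exec_seq ex1 (exec_seq ex2 ex3).
split; first by rewrite s3E /upd eqxx; case: eqP => //; lia.
move=> r rm; rewrite s3E /upd; case: eqP => [|_]; first lia.
by case: eqP => [|_]; [lia | rewrite s2lt ?s1lt //; lia].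
Qed.

Lemma upd_eq s r v : upd s r v r = v.
Proof. by rewrite /upd eqxx. Qed.

Lemma upd_ne s r v r' : r' != r -> upd s r v r' = s r'.
Proof. by rewrite /upd => /negbTE ->. Qed.

(** [prec_graph] recurses downwards while the compiled loop counts upwards; the sequence of
    intermediate values links the two. *)
Lemma prec_chain n (F : n.-tuple nat -> nat -> Prop) G N v y :
  prec_graph F G N v y -> exists zs : nat -> nat,
  [/\ F v (zs 0), forall p, p < N -> G [tuple of p :: zs p :: v] (zs p.+1)
    & zs N = y].
Proof.
elim: N y => [|N IH] y /=; first by move=> Fy; exists (fun=> y).
case=> z [/IH[zs [F0 GS zsN]] Gy].
exists (upd zs N.+1 y); split; last exact: upd_eq.
  by rewrite upd_ne.
move=> p; rewrite ltnS leq_eqVlt => /orP[/eqP->|pN].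
  by rewrite upd_eq upd_ne ?zsN //; lia.
by rewrite !upd_ne; [exact: GS| lia | lia].
Qed.

Lemma compile_prec n (h : recfun n) (g : recfun n.+2) :
  compiles h -> compiles g -> compiles (Rprec h g).
Proof.
move=> Ch Cg v y /= hgy s args m lt_m args_v.
case: args => [|a0 as_] in lt_m args_v *.
  by have := size_tuple v; rewrite -args_v.
have [a0m as_m] : a0 < m /\ all (gtn m) as_ by apply/andP.
have v0 : thead v = s a0 by rewrite /thead (tnth_nth 0) -args_v.
have vb : map s as_ = [tuple of behead v] by rewrite /= -args_v.
move: hgy; rewrite v0; set vs := [tuple of behead v] in vb *.
case/prec_chain=> zs [hz gz zN].
have as_m3 : all (gtn m.+3) as_ by apply: sub_all as_m => r /=; lia.
have [//|//|s1 ex1 [s1y s1lt]] := Ch vs _ hz s as_ m.+3.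
have [||| s2 ex2 s2E] := @exec_copy m.+3 m m.+4 s1; try lia.
have [s3 ex3 s3E] := exec_clear m.+1 s2.
have [||| s4 ex4 s4E] := @exec_copy a0 m.+2 m.+3 s3; try lia.
have s4lt r : r < m -> s4 r = s r.
  move=> rm; rewrite s4E !upd_ne; try lia.
  by rewrite s3E upd_ne ?s2E ?upd_ne ?s1lt; lia.
have s4a : s4 m.+2 = s a0.
  rewrite s4E upd_ne ?upd_eq; try lia.
  by rewrite s3E upd_ne ?s2E ?upd_ne ?s1lt; lia.
have s4m : s4 m = zs 0.
  rewrite s4E !upd_ne; try lia.
  by rewrite s3E upd_ne ?s2E 1?upd_ne ?upd_eq -?s1y; lia.
have s4m1 : s4 m.+1 = 0 by rewrite s4E !upd_ne ?s3E ?upd_eq; lia.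
(* Loop invariant: register [m] holds the value at stage [p], [m.+1] the counter [p], and [m.+2] the
   number [q] of rounds left. *)
have loop q : forall p s5, p + q = s a0 -> (forall r, r < m -> s5 r = s r) ->
    s5 m = zs p -> s5 m.+1 = p -> s5 m.+2 = q ->
    exists2 s6, exec (Loop m.+2 (Seq (compile g [:: m.+1, m & as_] m.+3)
                           (Seq (copy m.+3 m m.+4) (Inc m.+1)))) s5 s6 &
      ret m y s s6.
  elim: q => [|q IH] p s5 pq s5lt s5m s5p s5q.
    exists s5; first exact: exec_loop0.
    by split=> //; rewrite s5m -zN; congr zs; lia.
  set s6 := upd s5 m.+2 q.
  have [|||s7 ex7 [s7y s7lt]] := Cg _ _ (gz p _) s6 [:: m.+1, m & as_] m.+3; first lia.
  - by rewrite /= as_m3 andbT; lia.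
  - rewrite /= /s6 !upd_ne ?s5p ?s5m; try lia.
    congr [:: _, _ & _]; rewrite -args_v /=; apply: map_ext_lt as_m _ => r rm.
    by rewrite upd_ne ?s5lt //; lia.
  have [||| s8 ex8 s8E] := @exec_copy m.+3 m m.+4 s7; try lia.
  set s9 := upd s8 m.+1 (s8 m.+1).+1.
  have [|||||s10 ex10 s10P] := IH p.+1 s9.
  - by lia.
  - move=> r rm; rewrite /s9 upd_ne ?s8E ?upd_ne ?s7lt /s6 ?upd_ne ?s5lt //; lia.
  - by rewrite /s9 upd_ne ?s8E 1?upd_ne ?upd_eq ?s7y; lia.
  - by rewrite /s9 upd_eq s8E !upd_ne ?s7lt /s6 ?upd_ne ?s5p; lia.
  - by rewrite /s9 upd_ne ?s8E ?upd_ne ?s7lt /s6 ?upd_eq; lia.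
  exists s10 => //; apply: exec_loopS ex10; first by rewrite s5q.
  rewrite s5q; apply: exec_seq ex7 (exec_seq ex8 _); exact: exec_inc.
have [s5 ex5 s5P] := loop (s a0) 0 s4 (add0n _) s4lt s4m s4m1 s4a.
by exists s5 => //; apply: exec_seq (exec_seq ex1 ex2) (exec_seq (exec_seq ex3 ex4) ex5).
Qed.

Lemma compile_min n (h : recfun n.+1) : compiles h -> compiles (Rmin h).
Proof.
move=> Ch v y /= [hy h_lt] s args m lt_m args_v.
pose test := Seq (compile h (m :: args) m.+2) (copy m.+2 m.+1 m.+3).
have exec_test p z s0 : computes h [tuple of p :: v] z -> s0 m = p ->
    (forall r, r < m -> s0 r = s r) -> exists2 s1, exec test s0 s1 &
    [/\ s1 m = p, s1 m.+1 = z & forall r, r < m -> s1 r = s r].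
  move=> hz s0m s0lt.
  have [||s1 ex1 [s1y s1lt]] := Ch _ _ hz s0 (m :: args) m.+2.
  - by rewrite /= ltnW //; apply: sub_all lt_m => r /=; lia.
  - by rewrite /= s0m -args_v; congr cons; exact: map_ext_lt lt_m s0lt.
  have [|||s2 ex2 s2E] := @exec_copy m.+2 m.+1 m.+3 s1; try lia.
  exists s2; first exact: exec_seq ex1 ex2.
  split; first by rewrite s2E !upd_ne ?s1lt; lia.
    by rewrite s2E upd_ne ?upd_eq ?s1y; lia.
  by move=> r rm; rewrite s2E !upd_ne ?s1lt ?s0lt; lia.
(* Loop invariant: [m] holds the candidate [p] and [m.+1] the value of [h] there, which vanishes
   exactly when the distance [q] to [y] does. *)
have loop q : forall p s1, p + q = y -> s1 m = p ->
    (forall r, r < m -> s1 r = s r) -> computes h [tuple of p :: v] (s1 m.+1) ->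
    (q = 0 -> s1 m.+1 = 0) -> (0 < q -> s1 m.+1 <> 0) ->
    exists2 s2, exec (Loop m.+1 (Seq (clear m.+1) (Seq (Inc m) test))) s1 s2 &
      ret m y s s2.
  elim: q => [|q IH] p s1 pq s1m s1lt hp q0 qS.
    by exists s1; [apply: exec_loop0; exact: q0 | split=> //; lia].
  have [s2 ex2 s2E] := exec_clear m.+1 (upd s1 m.+1 (s1 m.+1).-1).
  set s3 := upd s2 m (s2 m).+1.
  have [z hz z0] : exists2 z, computes h [tuple of p.+1 :: v] z & (z == 0) = (q == 0).
    case: q pq {IH qS q0} => [|q] pq; first by exists 0 => //; rewrite (_ : p.+1 = y) //; lia.
    by have [|z hz] := h_lt p.+1; [lia | exists z.+1].
  have [||s4 ex4 [s4m s4z s4lt]] := exec_test p.+1 z s3 hz.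
  - by rewrite /s3 upd_eq s2E !upd_ne ?s1m; lia.
  - by move=> r rm; rewrite /s3 upd_ne ?s2E ?upd_ne ?s1lt; lia.
  have [|||||| s5 ex5 s5P] := IH p.+1 s4; rewrite ?s4z //; try lia.
  exists s5 => //; apply: exec_loopS ex5; first exact: qS.
  by apply: exec_seq ex2 (exec_seq _ ex4); exact: exec_inc.
have [s0 ex0 s0E] := exec_clear m s.
have [z hz z0] : exists2 z, computes h [tuple of 0 :: v] z & (z == 0) = (y == 0).
  case: y hy h_lt {loop} => [|y] hy h_lt; first by exists 0.
  by have [//|z hz] := h_lt 0; exists z.+1.
have [||s1 ex1 [s1m s1z s1lt]] := exec_test 0 z s0 hz.
- by rewrite s0E upd_eq.
- by move=> r rm; rewrite s0E upd_ne; lia.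
have [||||||s2 ex2 s2P] := loop y 0 s1; rewrite ?s1z //; try lia.
by exists s2 => //; apply: exec_seq (exec_seq ex0 ex1) ex2.
Qed.

Lemma compileP n (f : recfun n) : compiles f.
Proof.
elim: n / f => [n||n i|k n h Ch g Cg|n h Ch g Cg|n h Ch].
- move=> v y /= -> s args m _ _; have [s' ex s'E] := exec_clear m s.
  exists s' => //; split; first by rewrite s'E upd_eq.
  by move=> r rm; rewrite s'E upd_ne //; lia.
- move=> v y /= -> s [|a [|//]] m /=;
    first by move=> _ /(congr1 size); rewrite size_tuple.
    rewrite andbT => am v_eq; have [||| s1 ex1 s1E] := @exec_copy a m m.+1 s; try lia.
    exists (upd s1 m (s1 m).+1); first by apply: exec_seq ex1 _; exact: exec_inc.
    have va : thead v = s a by rewrite /thead (tnth_nth 0) -v_eq.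
    split; first by rewrite upd_eq s1E upd_ne ?upd_eq ?va; lia.
    by move=> r rm; rewrite upd_ne ?s1E ?upd_ne; lia.
  by move=> a' l _ /(congr1 size); rewrite size_tuple.
- move=> v y /= -> s args m lt_m args_v.
  have sz : size args = n by rewrite -(size_map s) args_v size_tuple.
  have im : nth 0 args i < m by apply: (allP lt_m); rewrite mem_nth // sz.
  have [||| s1 ex1 s1E] := @exec_copy (nth 0 args i) m m.+1 s; try lia.
  exists s1 => //; split; last by move=> r rm; rewrite s1E !upd_ne; lia.
  rewrite s1E upd_ne ?upd_eq; try lia.
  by rewrite (tnth_nth 0) -args_v (nth_map 0) // sz.
- exact: compile_comp.
- exact: compile_prec.
- exact: compile_min.
Qed.

(** * Computability of the codes, and the diagonal argument *)

Definition computable n (F : n.-tuple nat -> nat) :=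
  exists f : recfun n, forall v, computes f v (F v).

Lemma computable_ext n (F G : n.-tuple nat -> nat) :
  F =1 G -> computable F -> computable G.
Proof. by move=> FG [f fF]; exists f => v; rewrite -FG. Qed.

Lemma computable_proj n (i : 'I_n) : computable (fun v => tnth v i).
Proof. by exists (Rproj i). Qed.

Lemma computable_comp1 n (F : nat -> nat) (G : n.-tuple nat -> nat) :
  computable (fun v : 1.-tuple nat => F (thead v)) -> computable G ->
  computable (fun v => F (G v)).
Proof.
move=> [f fF] [g gG]; exists (Rcomp f (fun=> g)) => v /=.
exists [tuple G v]; split; last exact: fF.
by move=> i; rewrite ord1.
Qed.

Lemma computable_comp2 n (F : nat -> nat -> nat) (G H : n.-tuple nat -> nat) :
  computable (fun v : 2.-tuple nat => F (thead v) (tnth v ord_max)) ->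
  computable G -> computable H -> computable (fun v => F (G v) (H v)).
Proof.
move=> [f fF] [g gG] [h hH]; exists (Rcomp f (tnth [tuple g; h])) => v /=.
exists [tuple G v; H v]; split; last exact: fF.
by case=> [[|[|//]] ?].
Qed.

Lemma computable_succ n (G : n.-tuple nat -> nat) :
  computable G -> computable (fun v => (G v).+1).
Proof. by apply: (computable_comp1 (F := succn)); exists Rsucc. Qed.

Lemma computable_const n c : computable (fun _ : n.-tuple nat => c).
Proof. by elim: c => [|c IH]; [exists (Rzero n) | exact: computable_succ]. Qed.

Lemma computable_prec n (F : nat -> n.-tuple nat -> nat) (H : n.-tuple nat -> nat)
    (G : n.+2.-tuple nat -> nat) :
  F 0 =1 H -> (forall m v, F m.+1 v = G [tuple of m :: F m v :: v]) ->
  computable H -> computable G ->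
  computable (fun v : n.+1.-tuple nat => F (thead v) [tuple of behead v]).
Proof.
move=> F0 FS [h hH] [g gG]; exists (Rprec h g) => v /=.
elim: (thead v) => [|m IH] /=; first by rewrite F0.
by exists (F m [tuple of behead v]); split=> //; rewrite FS.
Qed.

Lemma computable_add n (G H : n.-tuple nat -> nat) :
  computable G -> computable H -> computable (fun v => G v + H v).
Proof.
apply: (computable_comp2 (F := addn)).
have [|||| a aP] := @computable_prec 1 (fun m v => m + thead v) (fun v => thead v)
  (fun v => (tnth v (lift ord0 ord0)).+1).
- by [].
- by [].
- exact: computable_proj.
- exact/computable_succ/computable_proj.
exists a => v; rewrite [tnth v _](_ : _ = thead [tuple of behead v]) //.
by rewrite /thead !(tnth_nth 0) /= nth_behead.
Qed.

Lemma computable_tri n (G : n.-tuple nat -> nat) :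
  computable G -> computable (fun v => 'C(G v, 2)).
Proof.
apply: (computable_comp1 (F := fun m => 'C(m, 2))).
apply: (@computable_prec 0 (fun m _ => 'C(m, 2)) (fun=> 0)
  (fun v => tnth v (lift ord0 ord0) + thead v)) => //.
- by move=> m v; rewrite binS bin1.
- exact: computable_const.
- by apply: computable_add; exact: computable_proj.
Qed.

Definition conn r a b := 4 * cpair a b + r.

Lemma computable_conn n r (G H : n.-tuple nat -> nat) :
  computable G -> computable H -> computable (fun v => conn r (G v) (H v)).
Proof.
move=> cG cH; have c4 (J : n.-tuple nat -> nat) :
    computable J -> computable (fun v => 4 * J v).
  move=> cJ; apply: (@computable_ext _ (fun v => (J v + J v) + (J v + J v))).
    by move=> v; lia.
  by do !apply: computable_add.
apply: computable_add; last exact: computable_const.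
apply: c4; apply: computable_add => //; apply: computable_tri.
exact/computable_succ/computable_add.
Qed.

(** The action of [next_col] on codes, which makes [code (num 0 n)] a primitive recursion on [n]. *)
Definition conn_next (e : nat) :=
  conn 2 (conn 1 (code (fy false)) (conn 3 (code fA) (conn 2 (code (ybad ⊔ fy false)%F) e)))
         (conn 1 (code (fy true)) (conn 3 (code fA) (conn 2 (code (ybad ⊔ fy true)%F) e))).

Lemma code_And A B : code (A ⊓ B)%F = conn 1 (code A) (code B).
Proof. by []. Qed.

Lemma code_Or A B : code (A ⊔ B)%F = conn 2 (code A) (code B).
Proof. by []. Qed.

Lemma code_Imp A B : code (A ⇒ B)%F = conn 3 (code A) (code B).
Proof. by []. Qed.

(* Codes are unary numbers, too large to be evaluated. *)
Opaque code conn.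

Lemma code_num0 : code (num 0 0) = code (fz 0).
Proof. by []. Qed.

Lemma code_numS n : code (num 0 n.+1) = conn 1 (code (fb 0)) (conn_next (code (num 0 n))).
Proof.
have -> : num 0 n.+1 = (fb 0 ⊓ next_col (num 0 n))%F by [].
rewrite /next_col /conn_next.
by rewrite code_And code_Or !code_And !(code_Imp fA) !(code_Or _ (num 0 n)).
Qed.

Lemma code_num_computable :
  computable (fun v : 1.-tuple nat => code (num 0 (thead v))).
Proof.
have [|||| a aP] := @computable_prec 0 (fun m _ => code (num 0 m))
  (fun=> code (fz 0))
  (fun v => conn 1 (code (fb 0)) (conn_next (tnth v (lift ord0 ord0)))).
- by move=> v; exact: code_num0.
- by move=> m v; exact: code_numS.
- exact: computable_const.
- have cp : computable (fun v : 2.-tuple nat => tnth v (lift ord0 ord0)).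
    exact: computable_proj.
  have cn k : computable (fun v : 2.-tuple nat => conn 1 (code (fy k))
      (conn 3 (code fA) (conn 2 (code (ybad ⊔ fy k)%F) (tnth v (lift ord0 ord0))))).
    by do 3 (apply: computable_conn; first exact: computable_const).
  apply: computable_conn; first exact: computable_const.
  exact: computable_conn (cn false) (cn true).
by exists a.
Qed.

(** The theory enters only through its code [g], so this function is fixed before any machine is
    chosen, as self-reference requires. *)
Definition code_halting (g n : nat) :=
  conn 3 g (conn 3 (conn 1 (code fstart) (code (num 0 n))) (code fbot)).

Lemma code_haltingE P l n :
  code (halting_formula P l n) = code_halting (code (machine_theory P l)) n.
Proof. by rewrite /halting_formula !code_Imp code_And. Qed.

Lemma code_halting_computable :
  computable (fun v : 1.-tuple nat => code_halting (thead v) (thead v)).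
Proof.
have cp : computable (fun v : 1.-tuple nat => thead v) by exact: computable_proj.
apply: computable_conn => //.
apply: computable_conn; last exact: computable_const.
by apply: computable_conn; [exact: computable_const | exact: code_num_computable].
Qed.

(* Computes [e] from register 0 into register 1, then exits if the result is
   zero and loops at address 1 otherwise. *)
Definition test_body (e : recfun 1) := flat (compile e [:: 0] 1) 2 0.

Definition test_program (e : recfun 1) : seq instr :=
  [:: IDec 1 (2 + size (test_body e).2) 1; IInc 0 1] ++ (test_body e).2.

Lemma test_program_reach (e : recfun 1) n b : computes e [tuple n] b ->
  exists t, (iter t (step (test_program e)) ((test_body e).1, upd (fun=> 0) 0 n)).1 =
            if b == 0 then size (test_program e) else 1.
Proof.
move=> eb; have [||s ex [sb _]] :=
  compileP eb (s := upd (fun=> 0) 0 n) (args := [:: 0]) (m := 1).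
- by [].
- by rewrite /= upd_eq.
have [t reach_t] := @flat_reach _ _ _ ex
  [:: IDec 1 (2 + size (test_body e).2) 1; IInc 0 1] [::] 2 0 erefl.
(* The body exits to address 0; the extra step is the test of register 1 there. *)
rewrite cats0 in reach_t; exists t.+1; rewrite iterS reach_t /step /= sb.
by case: b {eb sb} => [|b].
Qed.

Lemma test_program_loop (e : recfun 1) t s :
  s.1 = 1 -> (iter t (step (test_program e)) s).1 = 1.
Proof. by move=> s1; elim: t => //= t; rewrite {2}/step => ->. Qed.

Lemma halted_iter P t s : size P <= s.1 -> iter t (step P) s = s.
Proof.
by move=> halted; elim: t => //= t ->; rewrite /step onth_default.
Qed.

Theorem theorem6p1 (L : formula -> Prop)
    (TWJp_sub_L : forall A : formula, TWJp A -> L A)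
    (L_sub_Log : forall A : formula, L A -> LogPfin A) :
  ~ rec_decidable L.
Proof.
move=> [f f_dec]; have [g gP] := code_halting_computable.
pose e := Rcomp f (fun _ : 'I_1 => g).
pose P := test_program e; pose l := (test_body e).1.
(* [P] is built from [f] and [g] alone and its theory does not mention the input, so there is no
   circularity in feeding it this code. *)
pose n := code (machine_theory P l).
have [b [fb Lb]] := f_dec (halting_formula P l n).
have eb : computes e [tuple n] b.
  exists [tuple code_halting n n]; split; last by rewrite code_haltingE in fb.
  by move=> i; rewrite ord1; exact: gP.
have [t reach_t] := test_program_reach eb.
(* A negative answer makes the run halt, so the formula is derivable and lies in [L] after all. *)
case: b => [|] /= in fb Lb eb reach_t; last first.
  have /Lb// : L (halting_formula P l n).
  exact/TWJp_sub_L/(halting_derivable reach_t).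
pose run t := iter t (step P) (l, upd (fun=> 0) 0 n).
(* A halted run is stationary at an address of at least [size P], whereas this one ends up trapped
   at address 1. *)
have live t' : (run t').1 < size P.
  rewrite ltnNge; apply/negP => halted.
  have loops : (run (t' + t)).1 = 1 by rewrite /run iterD test_program_loop.
  have : (run (t + t')).1 = (run t').1 by rewrite /run iterD halted_iter.
  by rewrite addnC loops => run1; rewrite -run1 in halted.
(* After a positive answer the formula is in [L], yet the infinite run refutes it. *)
apply: (nonhalting_refuted (run := run) (n := n)) live _ => //.
by apply: L_sub_Log; apply/Lb.
Qed.
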